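(* Let $X_t$ be a Lévy process on $\mathbb{R}$ with Lévy–Khinchine triplet $(A,\gamma,\nu)$ and infinitesimal generator $L$. Then $L$ can be written in convolution form: there exists a function $k$ on $\mathbb{R}\setminus\{0\}$ with $\int_{-a}^{a}|k(t)|\,dt<\infty$ for every $0<a<\infty$ such that, for every compactly supported $f\in C_0^2$, $$Lf=\frac{d}{dx}\,S\,\frac{d}{dx}f,\qquad\text{where}\qquad Sg(x)=\frac12 A\,g(x)+\int_{-\infty}^{\infty}k(y-x)\,g(y)\,dy .$$
   Context: A Lévy process $X_t$ ($X_0=0$ a.s., independent stationary increments, a.s. right continuous with left limits) has triplet $(A,\gamma,\nu)$ if $E\,e^{izX_t}=e^{-t\lambda(z)}$ with $\lambda(z)=\frac12Az^2-i\gamma z-\int_{-\infty}^\infty(e^{ixz}-1-ixz1_{|x|<1})\,\nu(dx)$, where $A\ge0$, $\gamma\in\mathbb{R}$, and $\nu$ is a Borel measure on $\mathbb{R}$ with $\nu(\{0\})=0$ and $\int\frac{x^2}{1+x^2}\nu(dx)<\infty$. $C_0$ is the space of continuous functions on $\mathbb{R}$ tending to $0$ at $\pm\infty$ with the sup norm, and $C_0^2$ is the set of $f\in C_0$ with $f',f''\in C_0$. The generator $L$ of the transition semigroup of $X_t$ on $C_0$ acts on $f\in C_0^2$ by $$Lf(x)=\frac12Af''(x)+\gamma f'(x)+\int_{-\infty}^\infty\big(f(x+y)-f(x)-yf'(x)1_{|y|<1}\big)\nu(dy).$$ *)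

(* Defs.v *)
From HB Require Import structures.
From mathcomp Require Import all_boot all_order all_algebra.
From mathcomp Require Export complex.
From mathcomp Require Import all_classical all_reals all_analysis.
Set Implicit Arguments.
Unset Strict Implicit.
Unset Printing Implicit Defensive.
Import Order.TTheory GRing.Theory Num.Theory.
Import numFieldNormedType.Exports.

Local Open Scope classical_set_scope.
Local Open Scope complex_scope.
Local Open Scope ring_scope.

Section complex_valued.
Context {R : realType}.

Definition expC (z : R[i]) : R[i] :=
  (expR (complex.Re z) * cos (complex.Im z)) +i*
  (expR (complex.Re z) * sin (complex.Im z)).

Definition integralC d (T : measurableType d)
    (mu : {measure set T -> \bar R}) (f : T -> R[i]) : R[i] :=
  Rintegral mu setT (fun x => complex.Re (f x)) +i*
  Rintegral mu setT (fun x => complex.Im (f x)).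

End complex_valued.

Section levy_process.
Context d (T : measurableType d) (R : realType) (P : probability T R).

(* The sets [B i] may be [setT], so the product rule for the whole finite
   family contains the one for every subfamily. *)
Definition mutually_independent n (Y : 'I_n -> T -> R) : Prop :=
  forall B : 'I_n -> set (measurableTypeR R), (forall i, measurable (B i)) ->
    (P (\bigcap_(i in [set: 'I_n]) (Y i @^-1` B i)) =
     \prod_(i < n) P (Y i @^-1` B i))%E.

(* Time is [0, +oo[: the values [X t] for [t < 0] are never used. *)
Record levy_process (X : R -> {RV P >-> R}) : Prop := LevyProcess {
  levy_start : {ae P, forall w, X 0 w = 0} ;
  levy_independent : forall (n : nat) (t : nat -> R),
    0 <= t 0%N -> {homo t : i j / (i < j)%N >-> i < j} ->
    mutually_independent (fun (i : 'I_n) w => X (t i.+1) w - X (t i) w) ;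
  levy_stationary : forall s t : R, 0 <= s -> 0 <= t ->
    forall B : set (measurableTypeR R), measurable B ->
    P ((fun w => X (s + t) w - X s w) @^-1` B) =
    P ((fun w => X t w - X 0 w) @^-1` B) ;
  levy_cadlag : {ae P, forall w, forall t : R, 0 <= t ->
    (X s w @[s --> t^'+] --> X t w) /\
    (0 < t -> cvg (X s w @[s --> t^'-])) }
}.

End levy_process.

Section levy_khinchine.
Context {R : realType}.
Implicit Types (A gamma : R) (nu : {measure set (measurableTypeR R) -> \bar R}).

Definition levy_measure nu : Prop :=
  nu [set 0] = 0%E /\
  (\int[nu]_x ((x ^+ 2 / (1 + x ^+ 2))%:E) < +oo)%E.

(* lambda(z) = A z^2 / 2 - i gamma z
               - \int (e^{ixz} - 1 - i x z 1_{|x| < 1}) nu(dx) *)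
Definition levy_exponent A gamma nu (z : R) : R[i] :=
  (A / 2 * z ^+ 2)%:C - 'i%C * (gamma * z)%:C
  - integralC nu (fun x : R =>
      expC ('i%C * (x * z)%:C) - 1
      - 'i%C * (x * z * (`|x| < 1)%R%:R)%:C).

Definition levy_triplet d (T : measurableType d) (P : probability T R)
    (X : R -> {RV P >-> R}) A gamma nu : Prop :=
  [/\ 0 <= A, levy_measure nu &
      forall t z : R, 0 <= t ->
        integralC P (fun w => expC ('i%C * (z * X t w)%:C)) =
        expC (- (t%:C * levy_exponent A gamma nu z))].

End levy_khinchine.

Section generator.
Context {R : realType}.

Definition C0 (f : R -> R) : Prop :=
  [/\ continuous f, f x @[x --> +oo] --> 0 & f x @[x --> -oo] --> 0].

Definition C0_2 (f : R -> R) : Prop :=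
  [/\ C0 f,
      (forall x, derivable f x 1) /\ C0 (derive1 f) &
      (forall x, derivable (derive1 f) x 1) /\ C0 (derive1 (derive1 f))].

Definition compactly_supported (f : R -> R) : Prop :=
  compact (closure [set x | f x != 0]).

Context d (T : measurableType d) (P : probability T R) (X : R -> {RV P >-> R}).

Definition transition_semigroup (t : R) (f : R -> R) : R -> R :=
  fun x => Rintegral P setT (fun w => f (x + X t w)).

(* [f] is in the domain and [g] is its image: the difference quotients
   converge to [g] in sup norm. *)
Definition generator_graph (f g : R -> R) : Prop :=
  [/\ C0 f, C0 g &
      {uniform, (fun t => fun x => (transition_semigroup t f x - f x) / t)
                @ 0^'+ --> g}].

Definition generator_domain : set (R -> R) :=
  [set f | exists g, generator_graph f g].

(* The zero function outside the domain. *)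
Definition generator (f : R -> R) : R -> R :=
  xget (fun=> 0) [set g | generator_graph f g].

End generator.

Section convolution_form.
Context {R : realType}.

Definition locally_integrable_off0 (k : R -> R) : Prop :=
  forall a : R, 0 < a ->
    (@lebesgue_measure R).-integrable (`[- a, a] `\ 0) (EFin \o k).

(* [k] is meant as a function on [R \ {0}]: the point [y = x] is removed, so
   [k 0] is irrelevant. *)
Definition conv_operator (A : R) (k : R -> R) (g : R -> R) : R -> R :=
  fun x => A / 2 * g x +
    Rintegral (@lebesgue_measure R) [set~ x] (fun y => k (y - x) * g y).

End convolution_form.

(* Main.v *)
From HB Require Import structures.
Require Import Defs.
From mathcomp Require Import all_boot all_order all_algebra.
From mathcomp Require Import all_classical all_reals all_analysis.
From mathcomp Require Import measurable_realfun.
From mathcomp Require Import ring lra.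
Import Order.TTheory GRing.Theory Num.Theory.
Import numFieldNormedType.Exports.
Local Open Scope classical_set_scope.
Local Open Scope ring_scope.
Set Implicit Arguments.
Unset Strict Implicit.

(** The generator is computed first, then put in convolution form.

For [f(x) = exp (i z x)] the Lévy-Khinchine formula is Dynkin's formula: the mean
of [f (x + X_t)] is differentiable in [t], and its derivative is the mean of
[Lf (x + X_t)], where [L] is the integro-differential operator of the triplet
([levy_op]).  By linearity this extends to trigonometric polynomials
([has_dynkin_trig]).  A bounded [f] with two bounded derivatives, the second one
uniformly continuous, is a limit of trigonometric polynomials, bounded together
with their first two derivatives and convergent with them on every segment
([trig_approx], from Weierstrass' theorem and the substitution
[x = N sin (x / N) + o(1)]).  The operator [L] is continuous along such
approximations, because it is local up to jumps of small total weight
([levy_op_local_bound]).  With the mean value theorem this yields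
[E f (x + X_t) - f x - t Lf x = o(t)], uniformly in [x], since [X_t] tends to 0 in
probability ([uniform_increment_estimate]).  So [f] is in the domain of the
generator and its image is [Lf] ([generatorE]); the same local bound shows that
[Lf] is uniformly continuous and vanishes at infinity.

For the convolution form, Taylor's formula with integral remainder writes
[f (x + y) - f x - y f' x 1_{|y| < 1}] as the integral of an explicit function
[kernel_of_jump y u] of [u] against [f'' (x + u)] ([kernel_of_jump_pairing]).
Integrating in [y] against [nu] and adding a step for the drift gives the kernel
[k] ([conv_kernel]); Fubini's theorem and the integrability of [y^2 / (1 + y^2)]
show that [k] is locally integrable and that the integral of [k u f'' (x + u)] is
[Lf x - A f'' x / 2] ([conv_kernel_generator]).  This integral is the derivative
of that of [k u f' (x + u)] because [f''] is uniformly continuous and [f] has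
compact support ([is_derive_convolution]). *)

(** * Calculus on the line *)

Section calculus.
Variable R : realType.
Implicit Types (u f : R -> R).

Lemma ler_normD3 (a b c : R) : `|a + b + c| <= `|a| + `|b| + `|c|.
Proof. by apply: le_trans (ler_normD _ _) _; rewrite lerD2r ler_normD. Qed.

Lemma is_derive_unique (f : R -> R) (x a b : R) :
  is_derive x 1 f a -> is_derive x 1 f b -> a = b.
Proof. by move=> [_ <-] [_ <-]. Qed.

Lemma is_derive_of_increment (G : R -> R) (x l : R) :
  (forall e : R, 0 < e -> exists2 d : R, 0 < d & forall h, `|h| <= d ->
    `|G (x + h) - G x - h * l| <= e * `|h|) ->
  is_derive x 1 G l.
Proof.
move=> H.
have cv : h^-1 *: (G (h *: 1 + x) - G x) @[h --> 0^'] --> l.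
  apply/cvgrPdist_le => e /H[d d0 Hd].
  exists d => //= h; rewrite /ball_/= sub0r normrN => hd h0.
  have h0' : 0 < `|h| by rewrite normr_gt0.
  have := Hd h (ltW hd); rewrite /GRing.scale/= mulr1 (addrC h).
  move=> {}Hd.
  have -> : l - h^-1 * (G (x + h) - G x) = - (h^-1 * (G (x + h) - G x - h * l)).
    by field.
  by rewrite normrN normrM normfV ler_pdivrMl// [leRHS]mulrC.
apply: DeriveDef; first by apply/cvg_ex; exists l.
exact: cvg_lim.
Qed.

Lemma is_derive_cts u u1 : (forall y : R, is_derive y 1 u (u1 y)) -> continuous u.
Proof.
by move=> H y; have [Hy _] := H y; apply: differentiable_continuous;
  exact/derivable1_diffP.
Qed.

Lemma MVT_le {u u1} (x h C : R) : (forall y : R, is_derive y 1 u (u1 y)) ->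
  (forall y, `|y - x| <= `|h| -> `|u1 y| <= C) ->
  `|u (x + h) - u x| <= C * `|h|.
Proof.
move=> du bu1.
have cu a b : {within `[a, b], continuous u}.
  by apply: continuous_subspaceT; exact: is_derive_cts du.
have [h0|h0] := leP 0 h.
  have [|c] := @MVT_segment R u u1 x (x + h) _ (fun y _ => du y) (cu _ _).
    by rewrite lerDl.
  rewrite in_itv/= => /andP[xc ch] ->.
  rewrite addrAC subrr add0r normrM ler_wpM2r// bu1//.
  by rewrite !ger0_norm ?subr_ge0// lerBlDl.
have [|c] := @MVT_segment R u u1 (x + h) x _ (fun y _ => du y) (cu _ _).
  by rewrite gerDl ltW.
rewrite in_itv/= => /andP[xc ch] E.
rewrite distrC E opprD addrA subrr add0r normrM normrN ler_wpM2r// bu1//.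
rewrite distrC ger0_norm ?subr_ge0// ltr0_norm//; lra.
Qed.

Arguments MVT_le {u u1} x h C _ _.

Lemma taylor2_le {u u1 u2} (x h C : R) :
  (forall y : R, is_derive y 1 u (u1 y)) -> (forall y : R, is_derive y 1 u1 (u2 y)) ->
  (forall y, `|y - x| <= `|h| -> `|u2 y| <= C) ->
  `|u (x + h) - u x - h * u1 x| <= C * h ^+ 2.
Proof.
move=> du du1 bu2.
have C0 : 0 <= C by apply: le_trans (bu2 x _); rewrite // subrr normr0.
pose v y := u y - u1 x * y.
have dv (y : R) : is_derive y 1 v (u1 y - u1 x).
  have := du y => ?; apply: is_deriveB.
  by apply: trigger_derive; rewrite /GRing.scale/= mulr1.
have -> : u (x + h) - u x - h * u1 x = v (x + h) - v x by rewrite /v; ring.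
have -> : h ^+ 2 = `|h| * `|h| by rewrite -normrM -expr2 ger0_norm ?sqr_ge0.
rewrite mulrA; apply: (MVT_le x h (C * `|h|) dv) => y yh.
have {1}-> : y = x + (y - x) by ring.
apply: le_trans (MVT_le x (y - x) C du1 _) _.
  by move=> z zy; apply: bu2; exact: le_trans yh.
by rewrite ler_wpM2l.
Qed.

Arguments taylor2_le {u u1 u2} x h C _ _ _.

Definition unif_cts u := forall e : R, 0 < e ->
  exists2 d : R, 0 < d & forall x y : R, `|x - y| <= d -> `|u x - u y| <= e.

Lemma unif_cts_continuous u : unif_cts u -> continuous u.
Proof.
move=> ucu x; apply/cvgrPdist_le => e /ucu[d d0 H].
near=> y; apply: H; near: y; exact: cvgr_dist_le.
Unshelve. all: by end_near. Qed.

Lemma C0_tail f : C0 f ->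
  forall e : R, 0 < e -> exists2 M : R, 0 < M & forall x, M <= `|x| -> `|f x| <= e.
Proof.
move=> [_ /cvgrPdist_le fy /cvgrPdist_le fNy] e e0.
have [M1 [_ H1]] := fy _ e0; have [M2 [_ H2]] := fNy _ e0.
exists (`|M1| + `|M2| + 1); first by rewrite ltr_wpDl// addr_ge0.
move=> x; case: (leP 0 x) => x0.
  rewrite (ger0_norm x0) => Mx.
  suff /H1 : M1 < x by rewrite sub0r normrN.
  have := ler_norm M1; have := normr_ge0 M2; lra.
rewrite (ltr0_norm x0) => Mx.
suff /H2 : x < M2 by rewrite sub0r normrN.
have := ler_norm (- M2); rewrite normrN; have := normr_ge0 M1; lra.
Qed.

(** Only [x] is confined to the segment: a pair of close points straddling an
endpoint is covered, which is what glues the segment to the tails of a function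
vanishing at infinity. *)
Lemma segment_unif_cts f (M e : R) : continuous f -> 0 < e ->
  exists2 d : R, 0 < d & forall x y : R, `|x| <= M -> `|x - y| <= d -> `|f x - f y| <= e.
Proof.
move=> cf e0.
have /compact_near_coveringP/(_ R 0^'+
  (fun d x => forall y, `|x - y| <= d -> `|f x - f y| <= e)) :=
  @segment_compact R (- M) M.
move=> /(_ _ _)[].
  move=> x _.
  have /cvgr_dist_le/(_ (e / 2)) := cf x.
  move=> /(_ _)[]; first by rewrite divr_gt0.
  move=> d /= d0 H.
  exists (ball x (d / 2), [set t | t < d / 2]) => /=.
    split; first by apply: nbhsx_ballx; rewrite divr_gt0.
    by apply: nbhs_right_lt; rewrite divr_gt0.
  move=> [z t] /= [xz td] y zy.
  rewrite -ball_normE /ball_/= in xz.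
  have H1 : `|f x - f z| <= e / 2.
    by apply: H => /=; apply: lt_le_trans xz _; lra.
  have H2 : `|f x - f y| <= e / 2.
    apply: H => /=; have -> : x - y = (x - z) + (z - y) by ring.
    by apply: le_lt_trans (ler_normD _ _) _; lra.
  have -> : f z - f y = (f x - f y) - (f x - f z) by ring.
  by apply: le_trans (ler_normB _ _) _; lra.
move=> d /= d0 H.
exists (d / 2); first by rewrite divr_gt0.
move=> x y xM; apply: (H (d / 2)) => /=.
- by rewrite sub0r normrN ger0_norm; lra.
- by rewrite divr_gt0.
- by rewrite in_itv/= -ler_norml.
Qed.

Lemma C0_unif_cts f : C0 f -> unif_cts f.
Proof.
move=> Cf e e0; have [cf _ _] := Cf.
have [|M M0 HM] := @C0_tail f Cf (e / 2); first by rewrite divr_gt0.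
have [d d0 Hd] := @segment_unif_cts f (M + 1) e cf e0.
exists (Num.min d 1); first by rewrite lt_min d0 ltr01.
move=> x y; rewrite le_min => /andP[xyd xy1].
have [xM|xM] := leP `|x| (M + 1); first exact: Hd.
have H1 := HM x ltac:(lra).
have H2 : `|f y| <= e / 2.
  apply: HM; have := ler_normD (x - y) y; rewrite subrK; lra.
by apply: le_trans (ler_normB _ _) _; lra.
Qed.

Lemma C0_bounded f : C0 f -> exists2 C : R, 0 < C & forall x : R, `|f x| <= C.
Proof.
move=> Cf; have [cf _ _] := Cf.
have [//|M M0 HM] := @C0_tail f Cf 1.
have [|x _ Hx] := @EVT_max R (fun x => `|f x|) (- M) M ltac:(lra).
  by apply: continuous_subspaceT => x; apply: cvg_norm; exact: cf.
exists (`|f x| + 1) => [|y]; first by have := normr_ge0 (f x); lra.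
have [yM|/ltW yM] := leP `|y| M.
  have := Hx y; rewrite in_itv/= -ler_norml => /(_ yM); lra.
by have := HM y yM; have := normr_ge0 (f x); lra.
Qed.

Lemma sin_cos_near0 (t : R) :
  `|sin t - t| <= t ^+ 2 /\ `|cos t - 1| <= t ^+ 2.
Proof.
have ds (y : R) : is_derive y 1 (fun x => - sin x) (- cos y).
  by apply: is_deriveN.
have dc (y : R) : is_derive y 1 (fun x => cos x) (- sin y).
  exact: is_derive_cos.
split.
  have := @taylor2_le _ _ _ 0 t 1 (@is_derive_sin R) dc.
  rewrite sin0 cos0 subr0 mulr1 add0r mul1r; apply => y _.
  by rewrite normrN ler_norml sin_geN1 sin_le1.
have := @taylor2_le _ _ _ 0 t 1 dc ds.
rewrite sin0 cos0 oppr0 mulr0 subr0 add0r mul1r; apply => y _.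
by rewrite normrN ler_norml cos_geN1 cos_le1.
Qed.

End calculus.
Arguments MVT_le {R u u1} x h C _ _.
Arguments taylor2_le {R u u1 u2} x h C _ _ _.

(** * Polynomial and trigonometric approximation *)

Section weierstrass.
Variable R : realType.

(** The value at [s] of [bernstein n g] is the mean of [g] under the binomial
distribution of parameters [n] and [s], if [0 <= s <= 1].  The recursion conditions on the first
trial, which makes positivity and the variance immediate by induction. *)
Fixpoint bernstein n (g : nat -> R) : {poly R} :=
  if n is n'.+1
  then 'X * bernstein n' (g \o S) + (1 - 'X) * bernstein n' g
  else (g 0%N)%:P.

Lemma bernsteinS n g s : (bernstein n.+1 g).[s] =
  s * (bernstein n (g \o S)).[s] + (1 - s) * (bernstein n g).[s].
Proof. by rewrite /= !hornerE. Qed.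

Lemma bernstein_lin n (g h : nat -> R) a s :
  (bernstein n (fun k => g k + a * h k)).[s] =
  (bernstein n g).[s] + a * (bernstein n h).[s].
Proof.
elim: n g h => [|n IH] g h; first by rewrite /= !hornerE.
rewrite !bernsteinS IH (IH (g \o S) (h \o S)); ring.
Qed.

Lemma bernstein_le n (g h : nat -> R) s : 0 <= s <= 1 ->
  (forall k, g k <= h k) -> (bernstein n g).[s] <= (bernstein n h).[s].
Proof.
move=> /andP[s0 s1]; elim: n g h => [|n IH] g h gh.
  by rewrite /= !hornerE.
rewrite !bernsteinS lerD// ler_wpM2l ?subr_ge0// IH// => k.
exact: gh.
Qed.

Lemma bernstein_cst n c s : (bernstein n (fun=> c)).[s] = c.
Proof.
by elim: n => [|n IH]; [rewrite /= hornerC | rewrite bernsteinS [_ \o _]/= IH; ring].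
Qed.

(** The centre [a] is arbitrary because conditioning on a success of the first
trial shifts it by 1. *)
Lemma bernstein_var n a s :
  (bernstein n (fun k => (k%:R - a) ^+ 2)).[s] =
  n%:R * (s * (1 - s)) + (n%:R * s - a) ^+ 2.
Proof.
elim: n a => [|n IH] a; first by rewrite /= hornerC; ring.
rewrite bernsteinS IH.
rewrite (_ : _ \o S = fun k => (k%:R - (a - 1)) ^+ 2); last first.
  by apply/funext => k /=; rewrite -natr1; congr (_ ^+ 2); ring.
rewrite IH -natr1; ring.
Qed.

(** Chebyshev's inequality in quadratic form: [|f (k/n) - f s|] is at most [e / 2]
when [k/n] is close to the mean [s], and at most [2 M (k/n - s)^2 / d^2] when it
is at distance [d] or more. *)
Lemma weierstrass01 (f : R -> R) (M e : R) : unif_cts f ->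
  (forall x, `|f x| <= M) -> 0 < e ->
  exists p : {poly R}, forall s : R, 0 <= s <= 1 -> `|p.[s] - f s| <= e.
Proof.
move=> ucf fM e0.
have M0 : 0 <= M by apply: le_trans (fM 0).
have [|d d0 Hd] := ucf (e / 2); first by rewrite divr_gt0.
(* With more than [B] trials, the variance term [2 M s (1 - s) / (d^2 n)] is at
   most [e / 2]. *)
pose B := 4 * M / (d ^+ 2 * e).
have B0 : 0 <= B by rewrite divr_ge0 ?mulr_ge0 ?sqr_ge0// ltW.
pose n := (Num.truncn B).+1.
have nB : B < n%:R by rewrite /n truncnS_gt.
have n0 : (0 : R) < n%:R by rewrite ltr0n.
exists (bernstein n (fun k => f (k%:R / n%:R))) => s s01.
pose c := 2 * M / d ^+ 2 / n%:R ^+ 2.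
have c0 : 0 <= c.
  rewrite /c; apply: divr_ge0; last exact: sqr_ge0.
  by apply: divr_ge0; [rewrite mulr_ge0|exact: sqr_ge0].
have key k : `|f (k%:R / n%:R) - f s| <= e / 2 + c * (k%:R - n%:R * s) ^+ 2.
  have E : c * (k%:R - n%:R * s) ^+ 2 = 2 * M / d ^+ 2 * (k%:R / n%:R - s) ^+ 2.
    by rewrite /c; field; rewrite !gt_eqF.
  rewrite E.
  have E0 : 0 <= 2 * M / d ^+ 2 * (k%:R / n%:R - s) ^+ 2.
    by rewrite -E mulr_ge0 ?sqr_ge0.
  have [/Hd|] := leP `|k%:R / n%:R - s| d; first by lra.
  move=> dk; apply: (@le_trans _ _ (2 * M)).
    by apply: le_trans (ler_normB _ _) _; have := fM s; have := fM (k%:R / n%:R); lra.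
  apply: (@le_trans _ _ (2 * M / d ^+ 2 * (k%:R / n%:R - s) ^+ 2)); last by lra.
  rewrite mulrAC ler_pdivlMr ?exprn_gt0// ler_wpM2l// ?mulr_ge0//.
  by rewrite -(real_normK (num_real (_ - s))) lerXn2r// ?nnegrE ltW// (lt_trans d0).
have cvar : c * (n%:R * (s * (1 - s)) + (n%:R * s - n%:R * s) ^+ 2) <= e / 2.
  rewrite subrr expr0n/= addr0.
  have s1 : s * (1 - s) <= 1 by have /andP[? ?] := s01; nra.
  have ss0 : 0 <= s * (1 - s) by have /andP[? ?] := s01; rewrite mulr_ge0// subr_ge0.
  have -> : c * (n%:R * (s * (1 - s))) = (s * (1 - s)) * (2 * M / d ^+ 2 / n%:R).
    by rewrite /c; field; rewrite !gt_eqF.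
  apply: (@le_trans _ _ (1 * (2 * M / d ^+ 2 / n%:R))).
    rewrite ler_wpM2r// divr_ge0//.
    by apply: divr_ge0; [rewrite mulr_ge0|exact: sqr_ge0].
  rewrite mul1r ler_pdivrMr//.
  have : 4 * M < n%:R * (d ^+ 2 * e).
    by rewrite -ltr_pdivrMr// mulr_gt0 ?exprn_gt0.
  move=> H; rewrite ler_pdivrMr ?exprn_gt0//; lra.
rewrite ler_norml; apply/andP; split.
  have : (bernstein n (fun k => (f s - e / 2) + (- c) * (k%:R - n%:R * s) ^+ 2)).[s]
      <= (bernstein n (fun k => f (k%:R / n%:R))).[s].
    by apply: bernstein_le => // k; have := key k; rewrite ler_norml => /andP[]; lra.
  rewrite (bernstein_lin _ (fun=> _)) bernstein_cst bernstein_var; lra.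
have : (bernstein n (fun k => f (k%:R / n%:R))).[s] <=
    (bernstein n (fun k => (f s + e / 2) + c * (k%:R - n%:R * s) ^+ 2)).[s].
  by apply: bernstein_le => // k; have := key k; rewrite ler_norml => /andP[]; lra.
rewrite (bernstein_lin _ (fun=> _)) bernstein_cst bernstein_var; lra.
Qed.

Lemma weierstrass (f : R -> R) (M N e : R) : unif_cts f ->
  (forall x, `|f x| <= M) -> 0 < N -> 0 < e ->
  exists p : {poly R}, forall x : R, `|x| <= N -> `|p.[x] - f x| <= e.
Proof.
move=> ucf fM N0 e0.
have uch : unif_cts (fun s => f (N * (2 * s - 1))).
  move=> e' /ucf[d d0 H]; exists (d / (2 * N)); first by rewrite divr_gt0 ?mulr_gt0.
  move=> x y xy; apply: H.
  have -> : N * (2 * x - 1) - N * (2 * y - 1) = (2 * N) * (x - y) by ring.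
  have N20 : 0 < 2 * N by rewrite mulr_gt0.
  by rewrite normrM (gtr0_norm N20) -ler_pdivlMl// [leRHS]mulrC.
have [//|p Hp] := @weierstrass01 _ M e uch _ e0.
exists (p \Po ((2 * N)^-1 *: 'X + (2^-1)%:P)) => x.
rewrite ler_norml => /andP[xN xN'].
have -> : (p \Po ((2 * N)^-1 *: 'X + (2^-1)%:P)).[x] = p.[(x / N + 1) / 2].
  by rewrite horner_comp !hornerE; congr (p.[_]); field; rewrite gt_eqF.
have := Hp ((x / N + 1) / 2).
have -> : N * (2 * ((x / N + 1) / 2) - 1) = x by field; rewrite gt_eqF.
apply.
have : - 1 <= x / N by rewrite ler_pdivlMr//; lra.
have : x / N <= 1 by rewrite ler_pdivrMr//; lra.
by move=> *; apply/andP; split; lra.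
Qed.

Lemma poly_antiderivative (q : {poly R}) c : exists Q : {poly R},
  Q^`() = q /\ Q.[0] = c.
Proof.
exists (\poly_(i < (size q).+1) (if i is j.+1 then q`_j / i%:R else c)); split.
  apply/polyP => i; rewrite coef_deriv coef_poly ltnS.
  case: ltnP => [iq|iq]; last by rewrite mul0rn nth_default.
  by rewrite -[_ *+ _]mulr_natr divfK// pnatr_eq0.
by rewrite horner_coef0 coef_poly.
Qed.

(** It suffices to approximate [f2] and to take antiderivatives of the polynomial
with the initial values of [f1] and [f] at 0: each integration over [[- N, N]]
multiplies the error by at most [N]. *)
Lemma weierstrass_C2 (f f1 f2 : R -> R) (M N e : R) :
  (forall y : R, is_derive y 1 f (f1 y)) -> (forall y : R, is_derive y 1 f1 (f2 y)) ->
  unif_cts f2 -> (forall x, `|f2 x| <= M) -> 0 < N -> 0 < e ->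
  exists p : {poly R}, forall x : R, `|x| <= N ->
    [/\ `|p.[x] - f x| <= e, `|p^`().[x] - f1 x| <= e &
        `|p^`()^`().[x] - f2 x| <= e].
Proof.
move=> df df1 ucf fM N0 e0.
pose e' := e / (1 + N + N ^+ 2).
have D0 : 0 < 1 + N + N ^+ 2 by nra.
have e'0 : 0 < e' by rewrite divr_gt0.
have e'e : e' * (1 + N + N ^+ 2) = e by rewrite /e' divfK ?gt_eqF.
clearbody e'.
have [q Hq] := weierstrass ucf fM N0 e'0.
have [Q [dQ Q0]] := poly_antiderivative q (f1 0).
have [p [dp p0]] := poly_antiderivative Q (f 0).
have H1 (x : R) : `|x| <= N -> `|Q.[x] - f1 x| <= e' * N.
  move=> xN.
  have dd (y : R) : is_derive y 1 (fun x => Q.[x] - f1 x) (q.[y] - f2 y).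
    by rewrite -dQ; have := df1 y => ?; apply: is_deriveB.
  have /(_ e') := MVT_le 0 x _ dd; rewrite add0r Q0 subrr subr0 => H.
  apply: le_trans (H _) _; last by rewrite ler_wpM2l// ltW.
  by move=> y; rewrite subr0 => yx; apply: Hq; exact: le_trans xN.
have H0 (x : R) : `|x| <= N -> `|p.[x] - f x| <= e' * N * N.
  move=> xN.
  have dd (y : R) : is_derive y 1 (fun x => p.[x] - f x) (Q.[y] - f1 y).
    by rewrite -dp; have := df y => ?; apply: is_deriveB.
  have /(_ (e' * N)) := MVT_le 0 x _ dd; rewrite add0r p0 subrr subr0 => H.
  apply: le_trans (H _) _; last by rewrite ler_wpM2l// mulr_ge0// ltW.
  by move=> y; rewrite subr0 => yx; apply: H1; exact: le_trans xN.
exists p => x xN; rewrite dp dQ.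
have e'N : 0 < e' * N by rewrite mulr_gt0.
have e'N2 : 0 < e' * N * N by rewrite !mulr_gt0.
have E : e = e' + e' * N + e' * N * N by rewrite -e'e; ring.
by have := H0 x xN; have := H1 x xN; have := Hq x xN; split; lra.
Qed.

End weierstrass.

Section trigonometric_approximation.
Variable R : realType.

(** A polynomial in [sin (x / N)], hence a trigonometric polynomial; [trig1] and
[trig2] are its first two derivatives.  The factor [N] makes the inner function
tangent to the identity at 0. *)
Definition trig (N : R) (p : {poly R}) (x : R) := p.[N * sin (x / N)].
Definition trig1 (N : R) (p : {poly R}) (x : R) :=
  p^`().[N * sin (x / N)] * cos (x / N).
Definition trig2 (N : R) (p : {poly R}) (x : R) :=
  p^`()^`().[N * sin (x / N)] * cos (x / N) ^+ 2
  - p^`().[N * sin (x / N)] * (sin (x / N) / N).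

Lemma trig_derive (N : R) p (x : R) : N != 0 -> is_derive x 1 (trig N p) (trig1 N p x) /\
  is_derive x 1 (trig1 N p) (trig2 N p x).
Proof.
move=> N0.
have dl (y : R) : is_derive y 1 (fun z : R => z / N) N^-1.
  have -> : (fun z : R => z / N) = N^-1 \*: id.
    by apply/funext => z /=; rewrite /GRing.scale/= mulrC.
  by apply: trigger_derive; rewrite /GRing.scale/= mulr1.
have ds (y : R) : is_derive y 1 (fun z : R => sin (z / N)) (cos (y / N) * N^-1).
  exact: (is_derive1_comp (is_derive_sin _) (dl y)).
have dc (y : R) : is_derive y 1 (fun z : R => cos (z / N)) (- sin (y / N) * N^-1).
  exact: (is_derive1_comp (is_derive_cos _) (dl y)).
have dNs (y : R) : is_derive y 1 (fun z : R => N * sin (z / N)) (cos (y / N)).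
  have := ds y => ?; apply: trigger_derive; rewrite /GRing.scale/=.
  by rewrite mulrC divfK.
have dpol (q : {poly R}) (y : R) : is_derive y 1 (fun z => q.[N * sin (z / N)])
    (q^`().[N * sin (y / N)] * cos (y / N)).
  exact: (is_derive1_comp (is_derive_poly q _) (dNs y)).
split; first exact: dpol.
have := dpol p^`() x; have := dc x => ? ?.
apply: trigger_derive; rewrite /GRing.scale/= /trig2. ring.
Qed.

(** The map [x |-> N sin (x / N)] tends to the identity with its first two
derivatives, locally uniformly, while it takes values in the segment
[[- N, N]], on which a polynomial is close to [f] in the C^2 sense.  So the
composite is a trigonometric polynomial close to [f] on any fixed segment and
bounded everywhere together with its derivatives. *)
Lemma trig_approx (f f1 f2 : R -> R) (C e M : R) :
  (forall y : R, is_derive y 1 f (f1 y)) -> (forall y : R, is_derive y 1 f1 (f2 y)) ->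
  unif_cts f2 ->
  (forall x, [/\ `|f x| <= C, `|f1 x| <= C & `|f2 x| <= C]) ->
  0 < e -> e <= 1 -> 0 < M ->
  exists (N : R) (p : {poly R}), [/\ N != 0,
    (forall x : R, [/\ `|trig N p x| <= 2 * (C + 1), `|trig1 N p x| <= 2 * (C + 1) &
      `|trig2 N p x| <= 2 * (C + 1)]) &
    (forall x : R, `|x| <= M -> [/\ `|trig N p x - f x| <= e,
      `|trig1 N p x - f1 x| <= e & `|trig2 N p x - f2 x| <= e])].
Proof.
move=> df df1 ucf bf e0 e1 M0.
have C0 : 0 <= C by apply: le_trans (normr_ge0 (f 0)) _; have [] := bf 0.
have [|d d0 Hd] := ucf (e / 4); first by rewrite divr_gt0.
(* For [|x| <= M] the point [K sin (x / K)] is at distance at most [M^2 / K] from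
   [x]: the second term of [K] brings this below the modulus of continuity [d],
   the third one makes the other errors smaller than [e / 4]. *)
pose K := 1 + M ^+ 2 / d + 4 * (C + 1) * (1 + M ^+ 2) / (e / 4).
have K1 : 1 <= K.
  have : 0 <= M ^+ 2 / d by rewrite divr_ge0 ?sqr_ge0// ltW.
  have : 0 <= 4 * (C + 1) * (1 + M ^+ 2) / (e / 4).
    by rewrite divr_ge0// ?mulr_ge0// ?addr_ge0 ?sqr_ge0//; lra.
  rewrite /K; lra.
have K0 : 0 < K by lra.
have Kd : M ^+ 2 / K <= d.
  rewrite ler_pdivrMr// mulrC -ler_pdivrMr// /K.
  have : 0 <= 4 * (C + 1) * (1 + M ^+ 2) / (e / 4).
    by rewrite divr_ge0// ?mulr_ge0// ?addr_ge0 ?sqr_ge0//; lra.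
  lra.
have Ke : 4 * (C + 1) * (1 + M ^+ 2) / K <= e / 4.
  rewrite ler_pdivrMr// [leRHS]mulrC -ler_pdivrMr ?divr_gt0// /K.
  have : 0 <= M ^+ 2 / d by rewrite divr_ge0 ?sqr_ge0// ltW.
  lra.
clearbody K.
have bf2 x : `|f2 x| <= C by have [] := bf x.
have e40 : 0 < e / 4 by rewrite divr_gt0.
have [p Hp] := weierstrass_C2 df df1 ucf bf2 K0 e40.
exists K, p; split; first by rewrite gt_eqF.
  move=> x; rewrite /trig /trig1 /trig2.
  have bs : `|K * sin (x / K)| <= K.
    rewrite normrM (gtr0_norm K0) -[leRHS]mulr1 ler_wpM2l ?(ltW K0)//.
    by rewrite ler_norml sin_geN1 sin_le1.
  have [h0 h1 h2] := Hp _ bs; have [b0 b1 b2] := bf (K * sin (x / K)).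
  set s := K * sin (x / K) in h0 h1 h2 b0 b1 b2 *.
  have c1 : `|cos (x / K)| <= 1 by rewrite ler_norml cos_geN1 cos_le1.
  have s1 : `|sin (x / K)| <= 1 by rewrite ler_norml sin_geN1 sin_le1.
  have q0 : `|p.[s]| <= C + 1.
    by rewrite -[p.[s]](subrK (f s)); apply: le_trans (ler_normD _ _) _; lra.
  have q1 : `|p^`().[s]| <= C + 1.
    by rewrite -[p^`().[s]](subrK (f1 s)); apply: le_trans (ler_normD _ _) _; lra.
  have q2 : `|p^`()^`().[s]| <= C + 1.
    by rewrite -[p^`()^`().[s]](subrK (f2 s)); apply: le_trans (ler_normD _ _) _; lra.
  have t1 : `|p^`().[s] * cos (x / K)| <= (C + 1) * 1 by rewrite normrM ler_pM.
  split; [lra|lra|].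
  apply: le_trans (ler_normB _ _) _.
  have -> : 2 * (C + 1) = (C + 1) * 1 + (C + 1) * 1 by ring.
  rewrite lerD// normrM ler_pM//.
    by rewrite normrX exprn_ile1.
  rewrite normrM normfV (gtr0_norm K0) ler_pdivrMr// mul1r.
  by apply: le_trans K1.
move=> x xM; rewrite /trig /trig1 /trig2.
have bs : `|K * sin (x / K)| <= K.
  rewrite normrM (gtr0_norm K0) -[leRHS]mulr1 ler_wpM2l ?(ltW K0)//.
  by rewrite ler_norml sin_geN1 sin_le1.
have [h0 h1 h2] := Hp _ bs.
have x2M : (x / K) ^+ 2 <= M ^+ 2 / K / K.
  rewrite exprMn exprVn expr2 -(expr2 x) expr2 invfM mulrA.
  rewrite !ler_wpM2r ?invr_ge0 ?(ltW K0)// -expr2 -(real_normK (num_real x)).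
  by rewrite lerXn2r// nnegrE (ltW M0).
have x2M' : M ^+ 2 / K / K <= M ^+ 2 / K.
  by rewrite ler_pdivrMr// ler_peMr// divr_ge0 ?sqr_ge0 ?ltW.
have [hs hc] := sin_cos_near0 (x / K).
have sx : `|K * sin (x / K) - x| <= M ^+ 2 / K.
  have -> : K * sin (x / K) - x = K * (sin (x / K) - x / K).
    by field; rewrite gt_eqF.
  rewrite normrM (gtr0_norm K0) -ler_pdivlMl// [leRHS]mulrC.
  by apply: le_trans hs x2M.
set s := K * sin (x / K) in h0 h1 h2 sx *.
set c := cos (x / K) in hc *.
have c1 : `|c| <= 1 by rewrite ler_norml cos_geN1 cos_le1.
have s1 : `|sin (x / K)| <= 1 by rewrite ler_norml sin_geN1 sin_le1.
pose m := M ^+ 2 / K.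
have m0 : 0 <= m by rewrite divr_ge0 ?sqr_ge0// ltW.
have hc' : `|c - 1| <= m by apply: le_trans hc (le_trans x2M x2M').
have mC : 4 * (C + 1) * K^-1 + 4 * (C + 1) * m <= e / 4.
  by move: Ke; rewrite /m => Ke; apply: le_trans Ke; rewrite le_eqVlt; apply/orP;
    left; apply/eqP; ring.
have Ki : 0 <= K^-1 by rewrite invr_ge0 ltW.
have CK : 0 <= (C + 1) * K^-1 by rewrite mulr_ge0//; lra.
have Cm : 0 <= C * m by rewrite mulr_ge0.
have e0' : 0 < e / 4 by lra.
have xs : x + (s - x) = s by rewrite addrC subrK.
have f0s : `|f s - f x| <= C * m.
  rewrite -{1}xs; apply: le_trans (MVT_le x (s - x) C df _) _.
    by move=> y _; have [] := bf y.
  by rewrite ler_wpM2l.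
have f1s : `|f1 s - f1 x| <= C * m.
  rewrite -{1}xs; apply: le_trans (MVT_le x (s - x) C df1 _) _.
    by move=> y _; have [] := bf y.
  by rewrite ler_wpM2l.
have f2s : `|f2 s - f2 x| <= e / 4 by apply: Hd; exact: le_trans Kd.
have [b0 b1 b2] := bf s.
have q1 : `|p^`().[s]| <= C + 1.
  by rewrite -[p^`().[s]](subrK (f1 s)); apply: le_trans (ler_normD _ _) _; lra.
have q2 : `|p^`()^`().[s]| <= C + 1.
  by rewrite -[p^`()^`().[s]](subrK (f2 s)); apply: le_trans (ler_normD _ _) _; lra.
have C1 : 0 <= C + 1 by lra.
split.
- have -> : p.[s] - f x = (p.[s] - f s) + (f s - f x) by ring.
  by apply: le_trans (ler_normD _ _) _; lra.
- have -> : p^`().[s] * c - f1 x =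
     (p^`().[s] - f1 s) + (f1 s - f1 x) + p^`().[s] * (c - 1) by ring.
  have : `|p^`().[s] * (c - 1)| <= (C + 1) * m by rewrite normrM ler_pM.
  by move=> ?; apply: le_trans (ler_normD3 _ _ _) _; lra.
- have -> : p^`()^`().[s] * c ^+ 2 - p^`().[s] * (sin (x / K) / K) - f2 x =
     (p^`()^`().[s] - f2 s) + (f2 s - f2 x) + p^`()^`().[s] * ((c + 1) * (c - 1))
     + - (p^`().[s] * (sin (x / K) / K)) by ring.
  have : `|p^`()^`().[s] * ((c + 1) * (c - 1))| <= (C + 1) * (2 * m).
    rewrite normrM ler_pM// normrM ler_pM//.
    by apply: le_trans (ler_normD _ _) _; rewrite normr1; lra.
  have : `|- (p^`().[s] * (sin (x / K) / K))| <= (C + 1) * (1 * K^-1).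
    by rewrite normrN normrM ler_pM// normrM ler_pM// ger0_norm.
  move=> ? ?; apply: le_trans (ler_normD _ _) _.
  by apply: le_trans (lerD (ler_normD3 _ _ _) (lexx _)) _; lra.
Qed.

End trigonometric_approximation.

(** * The operator attached to a triplet *)

Section real_integrable.
Context d (T : measurableType d) (R : realType) (mu : {measure set T -> \bar R}).

Lemma integrable_Rscale (g : T -> R) k : mu.-integrable setT (EFin \o g) ->
  mu.-integrable setT (EFin \o (fun x => k * g x)).
Proof.
by move=> /(integrableZl measurableT k); apply: eq_integrable => // x _ /=.
Qed.

Lemma integrable_Radd (g h : T -> R) : mu.-integrable setT (EFin \o g) ->
  mu.-integrable setT (EFin \o h) ->
  mu.-integrable setT (EFin \o (fun x => g x + h x)).
Proof.
by move=> ig /(integrableD measurableT ig); apply: eq_integrable => // x _ /=.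
Qed.

End real_integrable.

Section levy_operator.
Variable R : realType.
Implicit Types (u v f : R -> R) (nu : {measure set (measurableTypeR R) -> \bar R}).

(** The integrand of the generator: the effect on [u] of a jump from [x] to
[x + y], compensated at first order when the jump is small. *)
Definition jump u u1 (x y : R) : R := u (x + y) - u x - y * u1 x * (`|y| < 1)%R%:R.

(** Up to a factor 2 this is the minimum of 1 and [y^2], and it is the function
whose integral a Lévy measure makes finite. *)
Definition jump_weight (y : R) : R := y ^+ 2 / (1 + y ^+ 2).

(** The derivatives of [u] are arguments, since the operator is applied to
functions whose derivatives are explicit (trigonometric polynomials, translates,
linear combinations). *)
Definition levy_op (A gamma : R) nu u u1 u2 (x : R) : R :=
  A / 2 * u2 x + gamma * u1 x + \int[nu]_y jump u u1 x y.

Definition C2_bounded u u1 u2 (C : R) := [/\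
  forall y : R, is_derive y 1 u (u1 y), forall y : R, is_derive y 1 u1 (u2 y) &
  forall y : R, [/\ `|u y| <= C, `|u1 y| <= C & `|u2 y| <= C]].

Lemma jump_weight_ge0 y : 0 <= jump_weight y.
Proof. by rewrite /jump_weight divr_ge0 ?addr_ge0 ?sqr_ge0. Qed.

Lemma sqr_le_jump_weight (y : R) : `|y| <= 1 -> y ^+ 2 <= 2 * jump_weight y.
Proof.
move=> y1; have y2 : y ^+ 2 <= 1 by rewrite -(real_normK (num_real y)) exprn_ile1.
have y0 := sqr_ge0 y.
rewrite /jump_weight mulrA ler_pdivlMr; last by lra.
by rewrite mulrC ler_wpM2r//; lra.
Qed.

Lemma one_le_jump_weight (y : R) : 1 <= `|y| -> 1 <= 2 * jump_weight y.
Proof.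
move=> y1; have y2 : 1 <= y ^+ 2.
  by rewrite -(real_normK (num_real y)) exprn_ege1.
by rewrite /jump_weight mulrA ler_pdivlMr; lra.
Qed.

(** Taylor's formula for a small jump, the triangle inequality for a large one.
Only the values of [u] at distance at most [|y|] from [x] enter the bound, so a
local bound on [u] controls all the jumps of bounded size. *)
Lemma jump_le u u1 u2 (x y C : R) :
  (forall y : R, is_derive y 1 u (u1 y)) ->
  (forall y : R, is_derive y 1 u1 (u2 y)) ->
  (forall z, `|z - x| <= `|y| -> `|u z| <= C /\ `|u2 z| <= C) ->
  `|jump u u1 x y| <= 4 * C * jump_weight y.
Proof.
move=> du du1 bu.
have ux : `|u x| <= C by have [] := bu x; rewrite ?subrr ?normr0.
have C0 : 0 <= C by apply: le_trans ux.
rewrite /jump; have [y1|y1] := ltP `|y| 1.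
  rewrite mulr1; apply: (@le_trans _ _ (C * y ^+ 2)).
    by apply: (taylor2_le x y C du du1) => z /bu[].
  by have := sqr_le_jump_weight (ltW y1); have := jump_weight_ge0 y; nra.
rewrite mulr0 subr0; apply: (@le_trans _ _ (2 * C)).
  have uxy : `|u (x + y)| <= C by have [] := bu (x + y); rewrite // addrAC subrr add0r.
  by apply: le_trans (ler_normB _ _) _; lra.
by have := one_le_jump_weight y1; nra.
Qed.

Lemma measurable_jump_weight : measurable_fun setT jump_weight.
Proof.
apply: continuous_measurable_fun => x; apply: cvgM.
  exact: exprn_continuous.
apply: cvgV; first by rewrite gt_eqF// ltr_pwDl// sqr_ge0.
by apply: cvgD; [exact: cvg_cst|exact: exprn_continuous].
Qed.

Lemma measurable_jump u u1 x : continuous u -> measurable_fun setT (jump u u1 x).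
Proof.
move=> cu; rewrite /jump; apply: measurable_funB.
  apply: measurable_funB => //.
  apply: continuous_measurable_fun => y; apply: continuous_comp; last exact: cu.
  by apply: cvgD; [exact: cvg_cst|exact: cvg_id].
apply: measurable_funM; first exact: measurable_funM.
apply: (@measurableT_comp _ _ _ _ _ _ (fun b : bool => b%:R : R)) => //.
apply: measurable_fun_ltr => //.
Qed.

Definition far_weight (r y : R) : R := jump_weight y * (r <= `|y|)%R%:R.

Lemma far_weight_ge0 r y : 0 <= far_weight r y.
Proof. by rewrite /far_weight mulr_ge0 ?jump_weight_ge0// ler0n. Qed.

Lemma far_weight_le r y : far_weight r y <= jump_weight y.
Proof. by rewrite /far_weight ler_piMr ?jump_weight_ge0// lern1 leq_b1. Qed.

Lemma measurable_far_weight r : measurable_fun setT (far_weight r).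
Proof.
apply: measurable_funM; first exact: measurable_jump_weight.
apply: (@measurableT_comp _ _ _ _ _ _ (fun b : bool => b%:R : R)) => //.
by apply: measurable_fun_ler => //; exact: measurableT_comp.
Qed.

Section fixed_measure.
Variables (A gamma : R) (nu : {measure set (measurableTypeR R) -> \bar R}).
Hypothesis lnu : levy_measure nu.

Lemma integrable_jump_weight : nu.-integrable setT (EFin \o jump_weight).
Proof.
apply/integrableP; split; first by apply/measurable_EFinP; exact: measurable_jump_weight.
have [_] := lnu; apply: le_lt_trans; rewrite le_eqVlt; apply/orP; left; apply/eqP.
by apply: eq_integral => x _ /=; rewrite ger0_norm// jump_weight_ge0.
Qed.

Lemma integrable_of_jump_weight (g : R -> R) (C : R) :
  measurable_fun setT g -> (forall y, `|g y| <= C * jump_weight y) ->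
  nu.-integrable setT (EFin \o g).
Proof.
move=> mg gC.
have /(le_integrable measurableT) := integrableZl measurableT C integrable_jump_weight.
apply; first exact/measurable_EFinP.
by move=> y _ /=; rewrite lee_fin (le_trans (gC y))// ler_norm.
Qed.

Lemma integrable_jump u u1 u2 C x : C2_bounded u u1 u2 C ->
  nu.-integrable setT (EFin \o jump u u1 x).
Proof.
move=> [du du1 bu]; apply: (@integrable_of_jump_weight _ (4 * C)).
  by apply: measurable_jump; exact: is_derive_cts du.
by move=> y; apply: (jump_le du du1) => z _; have [] := bu z.
Qed.

Lemma jump_weight_tail (e : R) : 0 < e -> exists2 r : R, 0 < r &
  \int[nu]_y far_weight r y <= e.
Proof.
move=> e0.
have [] := @dominated_convergence _ _ _ nu setT measurableT
  (fun n => EFin \o far_weight n.+1%:R) (cst 0%E) (EFin \o jump_weight).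
- by move=> n; apply/measurable_EFinP; exact: measurable_far_weight.
- exact: measurable_cst.
- apply: aeW => y _; apply: cvg_near_cst; near=> n.
  rewrite /far_weight /= leNgt (_ : `|y| < n.+1%:R) ?mulr0//.
  near: n; exists (Num.truncn `|y|) => // n /= yn.
  by apply: lt_le_trans (truncnS_gt _) _; rewrite ler_nat ltnS.
- exact: integrable_jump_weight.
- apply: aeW => y n _ /=.
  by rewrite lee_fin ger0_norm ?far_weight_ge0 ?far_weight_le.
move=> _ _; rewrite integral_cst//= mul0e => /fine_cvgP[_].
move=> /cvgrPdist_le/(_ _ e0)[n _ /(_ n (leqnn n))] /=.
rewrite sub0r normrN => H; exists n.+1%:R => //.
by apply: le_trans H; exact: ler_norm.
Unshelve. all: by end_near. Qed.

(** The value of the operator at [x] is governed by the size of [u] and of its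
derivatives on a large window around [x]; far jumps see [u] outside the window,
but they have small total weight.  This single estimate gives the decay at
infinity of the image of a function, its uniform continuity, and the continuity
of the operator along the trigonometric approximation. *)
Lemma levy_op_local_bound : exists2 K : R, 0 < K & forall eta : R, 0 < eta ->
  exists2 r : R, 0 < r & forall u u1 u2 (C e x : R), C2_bounded u u1 u2 C ->
    (forall z, `|z - x| <= r -> [/\ `|u z| <= e, `|u1 z| <= e & `|u2 z| <= e]) ->
    `|levy_op A gamma nu u u1 u2 x| <= K * e + eta * C.
Proof.
pose W := \int[nu]_y jump_weight y.
have W0 : 0 <= W by apply: Rintegral_ge0 => y _; exact: jump_weight_ge0.
exists (`|A / 2| + `|gamma| + 4 * W + 1).
  by rewrite ltr_wpDl// !addr_ge0// mulr_ge0.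
move=> eta eta0; have [|r r0 Hr] := @jump_weight_tail (eta / 4).
  by rewrite divr_gt0.
exists r => // u u1 u2 C e x [du du1 bu] be.
have C0 : 0 <= C by have [+ _ _] := bu 0; apply: le_trans.
have [ex e1x e2x] := be x ltac:(by rewrite subrr normr0 ltW).
have e0 : 0 <= e by apply: le_trans ex.
have iwr : nu.-integrable setT (EFin \o far_weight r).
  apply: (@integrable_of_jump_weight _ 1); first exact: measurable_far_weight.
  by move=> y; rewrite mul1r ger0_norm ?far_weight_ge0 ?far_weight_le.
have ij : nu.-integrable setT (EFin \o jump u u1 x).
  by apply: (@integrable_jump u u1 u2 C).
have jb y : `|jump u u1 x y| <= 4 * e * jump_weight y + 4 * C * far_weight r y.
  have w0 := jump_weight_ge0 y.
  have [ry|yr] := leP r `|y|.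
    apply: (@le_trans _ _ (4 * C * jump_weight y)).
      by apply: (jump_le du du1) => z _; have [] := bu z.
    by rewrite /far_weight ry mulr1 lerDr mulr_ge0// mulr_ge0.
  apply: (@le_trans _ _ (4 * e * jump_weight y)).
    by apply: (jump_le du du1) => z zy; have [] := be z ltac:(lra).
  by rewrite lerDl mulr_ge0 ?far_weight_ge0// mulr_ge0.
have i1 : nu.-integrable setT (EFin \o (fun y => 4 * e * jump_weight y)).
  exact: integrable_Rscale integrable_jump_weight.
have i2 : nu.-integrable setT (EFin \o (fun y => 4 * C * far_weight r y)).
  exact: integrable_Rscale iwr.
have Ij : `|\int[nu]_y jump u u1 x y| <= 4 * e * W + 4 * C * (eta / 4).
  apply: le_trans (le_normr_Rintegral measurableT ij) _.
  apply: (@le_trans _ _ (\int[nu]_y (4 * e * jump_weight y + 4 * C * far_weight r y))).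
    apply: le_Rintegral => //; first exact: integrable_norm.
    exact: integrable_Radd i1 i2.
  rewrite RintegralD// !RintegralZl//; last exact: integrable_jump_weight.
  by rewrite lerD2l ler_wpM2l// mulr_ge0.
rewrite /levy_op; apply: le_trans (ler_normD3 _ _ _) _; rewrite !normrM.
have : `|A / 2| * `|u2 x| <= `|A / 2| * e by rewrite ler_wpM2l.
have : `|gamma| * `|u1 x| <= `|gamma| * e by rewrite ler_wpM2l.
rewrite normrM; lra.
Qed.

Lemma levy_op_lin u u1 u2 C v v1 v2 D a x :
  C2_bounded u u1 u2 C -> C2_bounded v v1 v2 D ->
  levy_op A gamma nu (fun y => u y + a * v y) (fun y => u1 y + a * v1 y)
    (fun y => u2 y + a * v2 y) x =
  levy_op A gamma nu u u1 u2 x + a * levy_op A gamma nu v v1 v2 x.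
Proof.
move=> bu bv; rewrite /levy_op.
have iu := integrable_jump x bu; have iv := integrable_jump x bv.
rewrite (_ : \int[nu]_y jump _ _ x y =
    \int[nu]_y (jump u u1 x y + a * jump v v1 x y)); last first.
  by apply: eq_Rintegral => y _; rewrite /jump; ring.
rewrite RintegralD// ?RintegralZl//; first by ring.
exact: integrable_Rscale iv.
Qed.

Lemma levy_op_shift u u1 u2 h x :
  levy_op A gamma nu (fun y => u (y + h)) (fun y => u1 (y + h))
    (fun y => u2 (y + h)) x = levy_op A gamma nu u u1 u2 (x + h).
Proof.
rewrite /levy_op; congr (_ + _); apply: eq_Rintegral => y _.
by rewrite /jump; have -> : x + y + h = x + h + y by rewrite addrAC.
Qed.

Lemma C2_bounded_lin u u1 u2 C v v1 v2 D a :
  C2_bounded u u1 u2 C -> C2_bounded v v1 v2 D ->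
  C2_bounded (fun y => u y + a * v y) (fun y => u1 y + a * v1 y)
    (fun y => u2 y + a * v2 y) (C + `|a| * D).
Proof.
move=> [du du1 bu] [dv dv1 bv]; split.
- by move=> y; have := du y; have := dv y => ? ?; apply: is_deriveD.
- by move=> y; have := du1 y; have := dv1 y => ? ?; apply: is_deriveD.
- move=> y; have [? ? ?] := bu y; have [? ? ?] := bv y.
  by split; apply: le_trans (ler_normD _ _) _; rewrite normrM lerD// ler_wpM2l.
Qed.

Lemma C2_bounded_shift u u1 u2 C h : C2_bounded u u1 u2 C ->
  C2_bounded (fun y => u (y + h)) (fun y => u1 (y + h)) (fun y => u2 (y + h)) C.
Proof.
move=> [du du1 bu].
have dh (y : R) : is_derive y 1 (fun y : R => y + h) 1.
  by apply: trigger_derive; rewrite addr0.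
split => // y; rewrite -[X in is_derive _ _ _ X]mulr1.
  exact: (is_derive1_comp (du _) (dh y)).
exact: (is_derive1_comp (du1 _) (dh y)).
Qed.

Lemma C2_bounded_unif_cts u u1 u2 C : C2_bounded u u1 u2 C ->
  unif_cts u /\ unif_cts u1.
Proof.
move=> [du du1 bu].
have C0 : 0 <= C by have [+ _ _] := bu 0; apply: le_trans.
have H (w w1 : R -> R) : (forall y : R, is_derive y 1 w (w1 y)) -> (forall y, `|w1 y| <= C) ->
    unif_cts w.
  move=> dw bw e e0; exists (e / (C + 1)).
    by rewrite divr_gt0// ltr_wpDl.
  move=> x y xy; have {1}-> : x = y + (x - y) by ring.
  apply: le_trans (MVT_le y (x - y) C dw _) _; first by move=> z _; exact: bw.
  have : (C + 1) * `|x - y| <= e by rewrite mulrC -ler_pdivlMr// ltr_wpDl.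
  by have := normr_ge0 (x - y); lra.
by split; [apply: H du _|apply: H du1 _] => y; have [] := bu y.
Qed.

(** By linearity and invariance under translation, an increment of the image is
the value of the operator at the difference of two translates of [u], which is
small together with its two derivatives. *)
Lemma levy_op_unif_cts u u1 u2 C : C2_bounded u u1 u2 C -> unif_cts u2 ->
  unif_cts (levy_op A gamma nu u u1 u2).
Proof.
move=> bu uc2 e e0; have [uc uc1] := C2_bounded_unif_cts bu.
have C0 : 0 <= C by have [_ _ /(_ 0)[+ _ _]] := bu; apply: le_trans.
have D0 : 0 <= C + `|-1| * C by rewrite addr_ge0// mulr_ge0.
have [K K0 /(_ (e / 2 / (C + `|-1| * C + 1)))[|r r0 H]] := levy_op_local_bound.
  by rewrite !divr_gt0// ltr_wpDl.
have e' : 0 < e / 2 / K by rewrite !divr_gt0.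
have [d0 d00 Dd0] := uc _ e'; have [d1 d10 Dd1] := uc1 _ e'.
have [d2 d20 Dd2] := uc2 _ e'.
exists (Num.min d0 (Num.min d1 d2)); first by rewrite !lt_min d00 d10.
move=> x y; rewrite !le_min => /and3P[xy0 xy1 xy2].
have bx := C2_bounded_shift (x - y) bu.
have bl := C2_bounded_lin (-1) bx bu.
have := H _ _ _ _ (e / 2 / K) y bl.
rewrite (levy_op_lin _ _ bx bu) levy_op_shift (addrC y) subrK mulN1r => {}H.
apply: le_trans (H _) _.
  move=> z _; rewrite !mulN1r.
  have E : z + (x - y) - z = x - y by rewrite addrAC subrr add0r.
  by split; [apply: Dd0|apply: Dd1|apply: Dd2]; rewrite E.
rewrite mulrC divfK ?gt_eqF// [leRHS]splitr lerD2l.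
rewrite -mulrA ger_pMr ?divr_gt0// mulrC ler_pdivrMr; last by rewrite ltr_wpDl.
by rewrite mul1r lerDl.
Qed.

Lemma levy_op_C0 u u1 u2 C : C2_bounded u u1 u2 C -> unif_cts u2 ->
  C0 u -> C0 u1 -> C0 u2 -> C0 (levy_op A gamma nu u u1 u2).
Proof.
move=> bu uc2 Cu Cu1 Cu2.
have C0 : 0 <= C by have [_ _ /(_ 0)[+ _ _]] := bu; apply: le_trans.
have H (e : R) : 0 < e -> exists M : R, forall x, M < `|x| ->
    `|levy_op A gamma nu u u1 u2 x| <= e.
  move=> e0.
  have [K K0 /(_ (e / 2 / (C + 1)))[|r r0 H]] := levy_op_local_bound.
    by rewrite !divr_gt0// ltr_wpDl.
  have e' : 0 < e / 2 / K by rewrite !divr_gt0.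
  have [M0 M00 HM0] := C0_tail Cu e'; have [M1 M10 HM1] := C0_tail Cu1 e'.
  have [M2 M20 HM2] := C0_tail Cu2 e'.
  exists (M0 + M1 + M2 + r) => x xM.
  have := H _ _ _ _ (e / 2 / K) x bu => {}H.
  apply: le_trans (H _) _.
    move=> z zx.
    have zM : M0 + M1 + M2 <= `|z|.
      have := ler_normD (x - z) z; rewrite subrK distrC; lra.
    by split; [apply: HM0|apply: HM1|apply: HM2]; lra.
  rewrite mulrC divfK ?gt_eqF// [leRHS]splitr lerD2l.
  rewrite -mulrA ger_pMr ?divr_gt0// mulrC ler_pdivrMr; last by rewrite ltr_wpDl.
  by rewrite mul1r lerDl.
split.
- exact/unif_cts_continuous/(levy_op_unif_cts bu uc2).
- apply/cvgrPdist_le => e /H[M HM]; exists M; split; first exact: num_real.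
  by move=> x /= Mx; rewrite sub0r normrN HM// (lt_le_trans Mx)// ler_norm.
- apply/cvgrPdist_le => e /H[M HM]; exists (- M); split; first exact: num_real.
  move=> x /= Mx; rewrite sub0r normrN HM//.
  by apply: (@lt_le_trans _ _ (- x)); [lra|rewrite -normrN ler_norm].
Qed.

End fixed_measure.
End levy_operator.

(** * Trigonometric polynomials along the process *)

Section process.
Local Open Scope complex_scope.
Local Open Scope ring_scope.
Context d (T : measurableType d) (R : realType) (P : probability T R).
Variables (X : R -> {RV P >-> R}) (A gamma : R).
Variable (nu : {measure set (measurableTypeR R) -> \bar R}).
Hypotheses (lX : levy_process X) (tX : levy_triplet X A gamma nu).

Let lnu : levy_measure nu. Proof. by have [] := tX. Qed.

Notation L := (levy_op A gamma nu).

Lemma integrable_bounded (g : T -> R) (C : R) : measurable_fun setT g ->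
  (forall w, `|g w| <= C) -> P.-integrable setT (EFin \o g).
Proof.
move=> mg gC; apply: (le_integrable measurableT (f := EFin \o g) (g := cst C%:E)).
- exact/measurable_EFinP.
- by move=> w _ /=; rewrite lee_fin (le_trans (gC w))// ler_norm.
- exact: finite_measure_integrable_cst.
Qed.

Lemma measurable_comp_process (g : R -> R) t : measurable_fun setT g ->
  measurable_fun setT (fun w => g (X t w)).
Proof. by move=> mg; apply: measurableT_comp. Qed.

Lemma Rintegral_indic_prob (S : set T) : measurable S ->
  \int[P]_w (\1_S w) = fine (P S).
Proof. by move=> mS; rewrite /Rintegral integral_indic// setIT. Qed.

Lemma Rintegral_cst_prob (r : R) : \int[P]_w (r : R) = r.
Proof.
rewrite Rintegral_cst// -[RHS]mulr1; congr (_ * _).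
exact: (congr1 fine (probability_setT P)).
Qed.

Lemma prob_cvg0 (S : nat -> set T) : (forall n, measurable (S n)) ->
  {ae P, forall w, \forall n \near \oo, ~ S n w} ->
  fine (P (S n)) @[n --> \oo] --> (0 : R).
Proof.
move=> mS aeS.
have [] := @dominated_convergence _ _ _ P setT measurableT
  (fun n => EFin \o \1_(S n)) (cst 0%E) (cst 1%E).
- by move=> n; apply/measurable_EFinP; exact: measurable_indic.
- exact: measurable_cst.
- apply: filterS aeS => w Sw _; apply: cvg_near_cst.
  apply: filterS Sw => n Sn /=; rewrite indicE memNset//.
- exact: finite_measure_integrable_cst.
- by apply: aeW => w n _ /=; rewrite indicE lee_fin ger0_norm// lern1 leq_b1.
move=> _ _; rewrite integral_cst//= mul0e => /fine_cvgP[_].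
apply: cvg_trans; apply: near_eq_cvg; apply: nearW => n /=.
by rewrite -Rintegral_indic_prob.
Qed.

Definition far (delta t : R) : set T := [set w | delta < `|X t w|].

Lemma measurable_far delta t : measurable (far delta t).
Proof.
rewrite (_ : far _ _ = (fun w => `|X t w|) @^-1` `]delta, +oo[); last first.
  by apply/seteqP; split => w; rewrite /far /= in_itv/= andbT.
rewrite -[X in measurable X]setTI.
have mf : measurable_fun setT (fun w => `|X t w|) by exact: measurableT_comp.
by apply: mf.
Qed.

(** Right continuity of the paths at time 0, where the process starts from 0,
gives convergence to 0 almost surely along any sequence of times, hence in
probability. *)
Lemma far_small_time delta eta : 0 < delta -> 0 < eta ->
  exists2 t0 : R, 0 < t0 & forall t, 0 < t -> t < t0 -> fine (P (far delta t)) <= eta.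
Proof.
move=> delta0 eta0.
have : fine (P (far delta t)) @[t --> 0^'+] --> (0 : R).
  apply/cvg_at_rightP => u [u0 ucvg].
  apply: prob_cvg0; first by move=> n; exact: measurable_far.
  have := levy_cadlag lX; have := levy_start lX.
  apply: filterS2 => w Xw0 /(_ 0 (lexx 0))[+ _]; rewrite Xw0 => /cvg_at_rightP.
  move=> /(_ u (conj u0 ucvg)) /cvgrPdist_lt/(_ _ delta0).
  apply: filterS => n; rewrite sub0r normrN /far /= => H.
  by apply/negP; rewrite -leNgt ltW.
move=> /cvgrPdist_le/(_ _ eta0)[r /= r0 H].
exists r => // t t0 tr; have := H t.
rewrite /ball_/= !sub0r !normrN (gtr0_norm t0) => /(_ tr t0).
by apply: le_trans; exact: ler_norm.
Qed.

Lemma far_large_distance t eta : 0 < eta ->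
  exists2 M : R, 0 < M & forall M', M <= M' -> fine (P (far M' t)) <= eta.
Proof.
move=> eta0.
have : fine (P (far n.+1%:R t)) @[n --> \oo] --> (0 : R).
  apply: prob_cvg0; first by move=> n; exact: measurable_far.
  apply: aeW => w; exists (Num.truncn `|X t w|) => // n /= Xn.
  apply/negP; rewrite -leNgt ltW//.
  by apply: lt_le_trans (truncnS_gt _) _; rewrite ler_nat ltnS.
move=> /cvgrPdist_le/(_ _ eta0)[n _ /(_ n (leqnn n))] /=.
rewrite sub0r normrN => H; exists n.+1%:R => // M' MM'.
apply: le_trans H; apply: le_trans (ler_norm _).
apply: fine_le; rewrite ?fin_num_measure//; try exact: measurable_far.
apply: le_measure; rewrite ?inE; try exact: measurable_far.
by move=> w; rewrite /far /=; exact: le_lt_trans.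
Qed.

Lemma expectation_le (h : R -> R) (delta t a b : R) : measurable_fun setT h ->
  0 <= a -> (forall y, `|y| <= delta -> `|h y| <= a) -> (forall y, `|h y| <= b) ->
  `|\int[P]_w h (X t w)| <= a + b * fine (P (far delta t)).
Proof.
move=> mh a0 ha hb.
have mS := measurable_far delta t.
have b0 : 0 <= b by apply: le_trans (hb 0).
have mhX := measurable_comp_process t mh.
have ih : P.-integrable setT (EFin \o (fun w => h (X t w))).
  by apply: (integrable_bounded mhX) => w; exact: hb.
have i1 : P.-integrable setT (EFin \o (fun w => b * \1_(far delta t) w)).
  apply: integrable_Rscale; apply: (@integrable_bounded _ 1).
    exact: measurable_indic.
  by move=> w; rewrite indicE ger0_norm// lern1 leq_b1.
have i0 : P.-integrable setT (EFin \o (fun w : T => a)).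
  exact: finite_measure_integrable_cst.
apply: le_trans (le_normr_Rintegral measurableT ih) _.
apply: (@le_trans _ _ (\int[P]_w (a + b * \1_(far delta t) w))).
  apply: le_Rintegral => //; first exact: integrable_norm.
    exact: integrable_Radd.
  move=> w _; rewrite indicE; have [wS|wS] := boolP (w \in far delta t).
    by rewrite mulr1 (le_trans (hb _))// lerDr.
  rewrite mulr0 addr0; apply: ha.
  by move: wS; rewrite notin_setE /far /= => /negP; rewrite -leNgt.
rewrite RintegralD// RintegralZl//; last first.
  apply: (@integrable_bounded _ 1); first exact: measurable_indic.
  by move=> w; rewrite indicE ger0_norm// lern1 leq_b1.
by rewrite Rintegral_cst_prob Rintegral_indic_prob.
Qed.

Lemma expectation_start (g : R -> R) x : measurable_fun setT g ->
  \int[P]_w g (x + X 0 w) = g x.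
Proof.
move=> mg.
have mg' : measurable_fun setT (fun w => g (x + X 0 w)).
  by apply: measurableT_comp => //; exact: measurable_funD.
transitivity (\int[P]_(w in setT) (cst (g x) w)).
  rewrite /Rintegral; congr fine; apply: ae_eq_integral => //.
  - by apply/measurable_EFinP; exact: mg'.
  - by apply/measurable_EFinP; exact: measurable_cst.
  - by apply: filterS (levy_start lX) => w /= -> _; rewrite addr0.
exact: Rintegral_cst_prob.
Qed.

Lemma expC_i (r : R) : expC ('i%C * r%:C) = (cos r +i* sin r)%C.
Proof.
have -> : 'i * r%:C = 0 +i* r.
  by apply/eqP; rewrite eq_complex /=; apply/andP; split; apply/eqP; ring.
by rewrite /expC /= expR0 !mul1r.
Qed.

(** The characteristic exponent is [- (growth z + i frequency z)]: the mean of
[exp (i z X_t)] has modulus [exp (t growth z)] and argument [t frequency z]. *)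
Definition growth z := - (A / 2 * z ^+ 2) + \int[nu]_x (cos (x * z) - 1).
Definition frequency z :=
  gamma * z + \int[nu]_x (sin (x * z) - x * z * (`|x| < 1)%R%:R).

Lemma levy_exponentE z :
  levy_exponent A gamma nu z = ((- growth z) +i* (- frequency z))%C.
Proof.
rewrite /levy_exponent /growth /frequency.
have E (x : R) : expC ('i * (x * z)%:C) - 1 - 'i * (x * z * (`|x| < 1)%R%:R)%:C =
    ((cos (x * z) - 1) +i* (sin (x * z) - x * z * (`|x| < 1)%R%:R))%C.
  by rewrite expC_i; apply/eqP; rewrite eq_complex /=; apply/andP; split; apply/eqP; ring.
have -> : integralC nu (fun x : R =>
    expC ('i * (x * z)%:C) - 1 - 'i * (x * z * (`|x| < 1)%R%:R)%:C) =
    (\int[nu]_x (cos (x * z) - 1)) +i*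
    (\int[nu]_x (sin (x * z) - x * z * (`|x| < 1)%R%:R)).
  by rewrite /integralC; congr (_ +i* _); apply: eq_Rintegral => x _; rewrite E.
by apply/eqP; rewrite eq_complex /=; apply/andP; split; apply/eqP; ring.
Qed.

Lemma expectation_cis (t z : R) : 0 <= t ->
  \int[P]_w cos (z * X t w) = expR (t * growth z) * cos (t * frequency z) /\
  \int[P]_w sin (z * X t w) = expR (t * growth z) * sin (t * frequency z).
Proof.
move=> t0; have [_ _ /(_ t z t0)] := tX.
rewrite levy_exponentE /integralC.
under eq_Rintegral do rewrite expC_i /=.
under [X in _ +i* X]eq_Rintegral do rewrite expC_i /=.
have -> : - (t%:C * (- growth z +i* - frequency z)) =
    (t * growth z) +i* (t * frequency z).
  by apply/eqP; rewrite eq_complex /=; apply/andP; split; apply/eqP; ring.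
by rewrite /expC /= => -[-> ->].
Qed.

Lemma C2_bounded_cos (z phi : R) : C2_bounded (fun y => cos (z * y + phi))
  (fun y => - z * sin (z * y + phi)) (fun y => - z ^+ 2 * cos (z * y + phi))
  (1 + `|z| + z ^+ 2).
Proof.
have dl (y : R) : is_derive y 1 (fun y : R => z * y + phi) z.
  by apply: trigger_derive; rewrite /GRing.scale/= mulr1 addr0.
have z2 : 0 <= z ^+ 2 by rewrite sqr_ge0.
split => [y|y|y].
- rewrite mulNr mulrC -mulNr.
  exact: (is_derive1_comp (is_derive_cos _) (dl y)).
- have := @is_derive1_comp R sin (fun y : R => z * y + phi) y _ _
    (is_derive_sin _) (dl y) => ?.
  by apply: trigger_derive; rewrite /GRing.scale/=; ring.
- have c1 : `|cos (z * y + phi)| <= 1 by rewrite ler_norml cos_geN1 cos_le1.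
  have s1 : `|sin (z * y + phi)| <= 1 by rewrite ler_norml sin_geN1 sin_le1.
  have z0 := normr_ge0 z.
  split; first by lra.
    rewrite normrM normrN; apply: (@le_trans _ _ (`|z| * 1)); last by lra.
    by rewrite ler_wpM2l.
  rewrite normrM normrN normrX real_normK ?num_real//.
  by apply: (@le_trans _ _ (z ^+ 2 * 1)); [rewrite ler_wpM2l|lra].
Qed.

Lemma sin_as_cos (r : R) : sin r = cos (r - pi / 2).
Proof. by rewrite cosB cos_pihalf sin_pihalf mulr0 add0r mulr1. Qed.

Lemma expectation_cos (t z psi : R) : 0 <= t ->
  \int[P]_w cos (z * X t w + psi) =
  expR (t * growth z) * cos (t * frequency z + psi).
Proof.
move=> t0; have [Ec Es] := expectation_cis z t0.
have mlin : measurable_fun setT (fun w => z * X t w) by exact: measurable_funM.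
have ic : P.-integrable setT (EFin \o (fun w => cos (z * X t w))).
  apply: (@integrable_bounded _ 1); last first.
    by move=> w; rewrite ler_norml cos_geN1 cos_le1.
  by apply: measurableT_comp => //; exact: continuous_measurable_fun (@continuous_cos R).
have isn : P.-integrable setT (EFin \o (fun w => sin (z * X t w))).
  apply: (@integrable_bounded _ 1); last first.
    by move=> w; rewrite ler_norml sin_geN1 sin_le1.
  by apply: measurableT_comp => //; exact: continuous_measurable_fun (@continuous_sin R).
rewrite (_ : \int[P]_w cos (z * X t w + psi) =
  \int[P]_w (cos psi * cos (z * X t w) + - sin psi * sin (z * X t w))); last first.
  by apply: eq_Rintegral => w _; rewrite cosD; ring.
rewrite RintegralD//; try exact: integrable_Rscale.
by rewrite !RintegralZl// Ec Es cosD; ring.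
Qed.

(** The exponential [exp (i z x)] is an eigenfunction of the operator, with
eigenvalue [growth z + i frequency z]; this is the real part of that identity,
after a phase shift. *)
Lemma levy_op_cos (z phi x : R) :
  L (fun y => cos (z * y + phi)) (fun y => - z * sin (z * y + phi))
    (fun y => - z ^+ 2 * cos (z * y + phi)) x =
  growth z * cos (z * x + phi) - frequency z * sin (z * x + phi).
Proof.
have ic : nu.-integrable setT (EFin \o (fun y => cos (y * z) - 1)).
  have := integrable_jump lnu 0 (C2_bounded_cos z 0).
  apply: eq_integrable => // y _ /=; rewrite /jump; congr EFin.
  by rewrite add0r !mulr0 !addr0 cos0 sin0 (mulrC z); ring.
have isn : nu.-integrable setT
    (EFin \o (fun y => sin (y * z) - y * z * (`|y| < 1)%R%:R)).
  have := integrable_jump lnu 0 (C2_bounded_cos z (- (pi / 2))).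
  apply: eq_integrable => // y _ /=; rewrite /jump; congr EFin.
  rewrite add0r !mulr0 !add0r cosN cos_pihalf sinN sin_pihalf -sin_as_cos (mulrC z).
  by ring.
rewrite /levy_op /growth /frequency.
rewrite (_ : \int[nu]_y jump _ _ x y = \int[nu]_y
  (cos (z * x + phi) * (cos (y * z) - 1) +
   - sin (z * x + phi) * (sin (y * z) - y * z * (`|y| < 1)%R%:R))); last first.
  apply: eq_Rintegral => y _; rewrite /jump.
  have -> : z * (x + y) + phi = (z * x + phi) + y * z by ring.
  by rewrite cosD; ring.
have i1 := integrable_Rscale (cos (z * x + phi)) ic.
have i2 := integrable_Rscale (- sin (z * x + phi)) isn.
rewrite (RintegralD measurableT i1 i2) (RintegralZl _ measurableT ic).
by rewrite (RintegralZl _ measurableT isn); ring.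
Qed.

Lemma levy_op_bounded : exists2 K : R, 0 < K & forall u u1 u2 C x,
  C2_bounded u u1 u2 C -> `|L u u1 u2 x| <= K * C.
Proof.
have [K K0 /(_ 1 ltr01)[r r0 H]] := levy_op_local_bound A gamma lnu.
exists (K + 1); first by rewrite addr_gt0.
move=> u u1 u2 C x bu; rewrite mulrDl; apply: (H _ _ _ _ _ _ bu) => z _.
by have [_ _] := bu.
Qed.

Definition smooth_bounded (u u1 u2 : R -> R) :=
  (exists C, C2_bounded u u1 u2 C) /\ unif_cts u2.

(** The differential form of Dynkin's formula.  The function [Phi] is defined
on the whole line so that two-sided derivatives make sense at time 0. *)
Definition dynkin (u u1 u2 : R -> R) := forall x, exists Phi : R -> R,
  (forall t, 0 <= t -> Phi t = \int[P]_w u (x + X t w)) /\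
  (forall t : R, 0 <= t -> is_derive t 1 Phi (\int[P]_w L u u1 u2 (x + X t w))).

Definition has_dynkin (u : R -> R) :=
  exists u1 u2, smooth_bounded u u1 u2 /\ dynkin u u1 u2.

Lemma smooth_bounded_cts u u1 u2 : smooth_bounded u u1 u2 ->
  continuous u /\ continuous (L u u1 u2).
Proof.
move=> [[C bu] uc]; split.
  by have [du _ _] := bu; exact: is_derive_cts du.
exact: unif_cts_continuous (levy_op_unif_cts A gamma lnu bu uc).
Qed.

Lemma measurable_shift_process (g : R -> R) x t : continuous g ->
  measurable_fun setT (fun w => g (x + X t w)).
Proof.
move=> cg; apply: (measurableT_comp (f := g)).
  exact: continuous_measurable_fun.
exact: measurable_funD.
Qed.

Lemma integrable_smooth u u1 u2 x t : smooth_bounded u u1 u2 ->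
  P.-integrable setT (EFin \o (fun w => u (x + X t w))) /\
  P.-integrable setT (EFin \o (fun w => L u u1 u2 (x + X t w))).
Proof.
move=> su; have [cu cLu] := smooth_bounded_cts su.
have [[C bu] _] := su; have [K _ HK] := levy_op_bounded; split.
  apply: (@integrable_bounded _ C); first exact: measurable_shift_process.
  by move=> w; have [_ _ /(_ (x + X t w))[]] := bu.
apply: (@integrable_bounded _ (K * C)); first exact: measurable_shift_process.
by move=> w; exact: HK.
Qed.

Lemma smooth_bounded_lin u u1 u2 v v1 v2 a :
  smooth_bounded u u1 u2 -> smooth_bounded v v1 v2 ->
  smooth_bounded (fun y => u y + a * v y) (fun y => u1 y + a * v1 y)
    (fun y => u2 y + a * v2 y).
Proof.
move=> [[C bu] ucu] [[D bv] ucv]; split.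
  by exists (C + `|a| * D); exact: C2_bounded_lin.
move=> e e0.
have [|d1 d10 H1] := ucu (e / 2); first by rewrite divr_gt0.
have a0 : 0 < `|a| + 1 by rewrite ltr_wpDl.
have [|d2 d20 H2] := ucv (e / 2 / (`|a| + 1)); first by rewrite !divr_gt0.
exists (Num.min d1 d2); first by rewrite lt_min d10.
move=> x y; rewrite le_min => /andP[/H1 h1 /H2 h2].
have -> : u2 x + a * v2 x - (u2 y + a * v2 y) =
  (u2 x - u2 y) + a * (v2 x - v2 y) by ring.
apply: le_trans (ler_normD _ _) _; rewrite normrM [leRHS]splitr lerD//.
apply: (@le_trans _ _ ((`|a| + 1) * `|v2 x - v2 y|)).
  by rewrite ler_wpM2r// lerDl.
by rewrite mulrC -ler_pdivlMr.
Qed.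

Lemma has_dynkin_lin u v a : has_dynkin u -> has_dynkin v ->
  has_dynkin (fun y => u y + a * v y).
Proof.
move=> [u1 [u2 [su du]]] [v1 [v2 [sv dv]]].
exists (fun y => u1 y + a * v1 y), (fun y => u2 y + a * v2 y); split.
  exact: smooth_bounded_lin.
move=> x; have [F [F0 F1]] := du x; have [G [G0 G1]] := dv x.
exists (fun t => F t + a * G t); split=> t t0.
  have [iu _] := integrable_smooth x t su; have [iv _] := integrable_smooth x t sv.
  rewrite F0// G0// RintegralD// ?RintegralZl//; exact: integrable_Rscale.
have [_ iu] := integrable_smooth x t su; have [_ iv] := integrable_smooth x t sv.
have [[C bu] _] := su; have [[D bv] _] := sv.
rewrite (_ : \int[P]_w _ = \int[P]_w (L u u1 u2 (x + X t w) +
    a * L v v1 v2 (x + X t w))); last first.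
  by apply: eq_Rintegral => w _; exact: (levy_op_lin A gamma lnu a _ bu bv).
rewrite RintegralD// ?RintegralZl//; last exact: integrable_Rscale.
have := F1 t t0; have := G1 t t0 => ? ?.
exact: is_deriveD.
Qed.

Lemma has_dynkin_cos (z phi : R) : has_dynkin (fun y => cos (z * y + phi)).
Proof.
have bc := C2_bounded_cos z phi.
have sc : smooth_bounded (fun y => cos (z * y + phi))
    (fun y => - z * sin (z * y + phi)) (fun y => - z ^+ 2 * cos (z * y + phi)).
  split; first by exists (1 + `|z| + z ^+ 2).
  move=> e e0; have [uc _] := C2_bounded_unif_cts bc.
  have z1 : 0 < z ^+ 2 + 1 by rewrite ltr_wpDl// sqr_ge0.
  have [|d1 d10 H1] := uc (e / (z ^+ 2 + 1)); first by rewrite divr_gt0.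
  exists d1 => // x y /H1 h1; rewrite -mulrBr normrM normrN (ger0_norm (sqr_ge0 z)).
  apply: (@le_trans _ _ ((z ^+ 2 + 1) * `|cos (z * x + phi) - cos (z * y + phi)|)).
    by rewrite ler_wpM2r// lerDl.
  by rewrite mulrC -ler_pdivlMr.
eexists; eexists; split; first exact: sc.
move=> x; exists (fun t => expR (t * growth z) * cos (t * frequency z + (z * x + phi))).
have Eu (t psi : R) : 0 <= t -> \int[P]_w cos (z * (x + X t w) + psi) =
    expR (t * growth z) * cos (t * frequency z + (z * x + psi)).
  move=> t0; rewrite -expectation_cos//; apply: eq_Rintegral => w _.
  by congr cos; ring.
split=> t t0; first by rewrite Eu.
rewrite (_ : \int[P]_w _ = \int[P]_w (growth z * cos (z * (x + X t w) + phi) +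
    - frequency z * cos (z * (x + X t w) + (phi - pi / 2)))); last first.
  apply: eq_Rintegral => w _; rewrite levy_op_cos addrA -sin_as_cos; ring.
have ic psi : P.-integrable setT (EFin \o (fun w => cos (z * (x + X t w) + psi))).
  apply: (@integrable_bounded _ 1); last first.
    by move=> w; rewrite ler_norml cos_geN1 cos_le1.
  apply: (@measurable_shift_process (fun y => cos (z * y + psi))).
  by have [dcos _ _] := C2_bounded_cos z psi; exact: is_derive_cts dcos.
rewrite RintegralD//; try exact: integrable_Rscale.
rewrite !RintegralZl// !Eu// !addrA -sin_as_cos -!addrA.
have dl (a b : R) : is_derive t 1 (fun t : R => t * a + b) a.
  by apply: trigger_derive; rewrite /GRing.scale/= mulr1 mulr0 addr0 add0r.
have dl0 (a : R) : is_derive t 1 (fun t : R => t * a) a.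
  by apply: trigger_derive; rewrite /GRing.scale/= mulr1 mulr0 add0r.
have dc := @is_derive1_comp R cos (fun t : R => t * frequency z + (z * x + phi))
  t _ _ (is_derive_cos _) (dl (frequency z) (z * x + phi)).
have de := @is_derive1_comp R expR (fun t : R => t * growth z)
  t _ _ (is_derive_expR _) (dl0 (growth z)).
by apply: trigger_derive; rewrite /GRing.scale/=; ring.
Qed.

(** The induction on [p] carries a factor [cos (z y + phi)]: multiplying it by
[sin (y / N)] gives a combination of two shifted cosines of frequencies [z + 1 / N] and
[z - 1 / N], to which the induction hypothesis applies. *)
Lemma has_dynkin_trig (N : R) (p : {poly R}) : N != 0 -> has_dynkin (trig N p).
Proof.
move=> N0.
suff H z phi : has_dynkin (fun y => p.[N * sin (y / N)] * cos (z * y + phi)).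
  have := H 0 0; congr has_dynkin; apply/funext => y.
  by rewrite mul0r addr0 cos0 mulr1.
elim/poly_ind: p z phi => [|p c IH] z phi.
  have := has_dynkin_lin (-1) (has_dynkin_cos z phi) (has_dynkin_cos z phi).
  by congr has_dynkin; apply/funext => y; rewrite horner0; ring.
have H1 := IH (z + N^-1) (phi - pi / 2).
have H2 := IH (z - N^-1) (phi - pi / 2).
have H12 := has_dynkin_lin (-1) H1 H2.
(* The coefficient of [H12] has to be [N / 2], which is [1 + (N / 2 - 1)]. *)
have := has_dynkin_lin c (has_dynkin_lin (N / 2 - 1) H12 H12) (has_dynkin_cos z phi).
congr has_dynkin; apply/funext => y; rewrite !addrA -!sin_as_cos hornerMXaddC.
have -> : (z + N^-1) * y + phi = (z * y + phi) + y / N by ring.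
have -> : (z - N^-1) * y + phi = (z * y + phi) - y / N by ring.
rewrite sinD sinB.
have -> : p.[N * sin (y / N)] *
  (sin (z * y + phi) * cos (y / N) + cos (z * y + phi) * sin (y / N)) +
  -1 * (p.[N * sin (y / N)] *
  (sin (z * y + phi) * cos (y / N) - cos (z * y + phi) * sin (y / N))) =
  2 * p.[N * sin (y / N)] * cos (z * y + phi) * sin (y / N) by ring.
by field.
Qed.

(** * The generator on twice differentiable functions *)

(** Dynkin's formula holds for the trigonometric approximations [g] of [f].  The
mean value theorem turns it into a bound on the increment of the mean of [g],
uniform over the intermediate time, in which [g] can be replaced by [f]: the
process is far from 0 with probability at most [p], and the rest is local. *)
Lemma increment_estimate : exists2 K : R, 0 < K & forall (f f1 f2 : R -> R) (C delta e p t : R),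
  C2_bounded f f1 f2 C -> unif_cts f2 -> 0 < delta -> 0 <= e -> 0 < t ->
  (forall y, `|y| <= delta -> `|L f f1 f2 y - L f f1 f2 0| <= e) ->
  (forall s, 0 < s -> s < t -> fine (P (far delta s)) <= p) ->
  `|\int[P]_w f (X t w) - f 0 - t * L f f1 f2 0| <= t * (e + K * (C + 1) * p).
Proof.
have [K K0 HK] := levy_op_bounded.
have [K' K'0 HK'] := levy_op_local_bound A gamma lnu.
exists (3 * K); first by rewrite mulr_gt0.
move=> f f1 f2 C delta e p t bf uc delta0 e0 t0 He Hp.
have [df df1 bf'] := bf.
have C0 : 0 <= C by apply: le_trans (normr_ge0 (f 0)) _; have [] := bf' 0.
pose D := 2 * (C + 1) + `|-1| * C.
have D0 : 0 <= D by rewrite addr_ge0// mulr_ge0// addr_ge0.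
apply/ler_addgt0Pr => eps eps0.
(* [Z] collects the coefficients of the approximation error [e'] in the final
   bound. *)
pose Z := 2 + D + t * (K' + D).
have Z0 : 0 < Z by rewrite ltr_wpDr ?ltr_wpDr// mulr_ge0 ?ltW// ltr_wpDr.
pose e' := Num.min 1 (eps / Z).
have e'0 : 0 < e' by rewrite lt_min ltr01 divr_gt0.
have e'1 : e' <= 1 by rewrite ge_min lexx.
have e'Z : e' * Z <= eps by rewrite -ler_pdivlMr// ge_min lexx orbT.
clearbody e'.
have [r r0 Hr] := HK' _ e'0.
have [M1 M10 HM1] := far_large_distance t e'0.
pose M := M1 + delta + r.
have M0 : 0 < M by rewrite !addr_gt0.
have [N [q [N0 bg ag]]] := trig_approx df df1 uc bf' e'0 e'1 M0.
set g := trig N q in bg ag; set g1 := trig1 N q in bg ag.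
set g2 := trig2 N q in bg ag.
have dg (y : R) := trig_derive q y N0.
have bG : C2_bounded g g1 g2 (2 * (C + 1)).
  by split => // y; have [] := dg y.
have [u1 [u2 [sg dyg]]] := has_dynkin_trig q N0.
have E1 : u1 = g1.
  apply/funext => y; have [[C' [d1 _ _]] _] := sg.
  by apply: (is_derive_unique (d1 y)); have [] := dg y.
have E2 : u2 = g2.
  apply/funext => y; have [[C' [_ d1 _]] _] := sg.
  by apply: (is_derive_unique (d1 y)); rewrite E1; have [] := dg y.
rewrite {}E1 {}E2 in sg dyg.
have bd := C2_bounded_lin (-1) bG bf; rewrite -/D in bd.
have sf : smooth_bounded f f1 f2 by split; first by exists C.
have [cg cLg] := smooth_bounded_cts sg.
have [cf _] := smooth_bounded_cts sf.
have Lgf y : `|y| <= delta -> `|L g g1 g2 y - L f f1 f2 y| <= K' * e' + e' * D.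
  move=> yd; rewrite -[- L f _ _ _]mulN1r -(levy_op_lin A gamma lnu _ _ bG bf).
  apply: (Hr _ _ _ _ _ _ bd) => z zy.
  have zM : `|z| <= M.
    have := ler_normD (z - y) y; rewrite subrK /M; lra.
  by have := ag z zM; rewrite !mulN1r.
have [Phi [Phi0 Phi1]] := dyg 0.
have cPhi : {within `[0, t], continuous Phi}.
  apply: derivable_within_continuous => s; rewrite in_itv/= => /andP[s0 _].
  by have [] := Phi1 s s0.
have dPhi (s : R) : s \in `]0, t[ ->
    is_derive s 1 Phi (\int[P]_w L g g1 g2 (0 + X s w)).
  by rewrite in_itv/= => /andP[s0 _]; exact: Phi1 (ltW s0).
have [c] := MVT t0 dPhi cPhi.
rewrite in_itv/= => /andP[c0 ct].
have -> : Phi t = \int[P]_w g (X t w).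
  by rewrite (Phi0 _ (ltW t0)); apply: eq_Rintegral => w _; rewrite add0r.
rewrite (Phi0 _ (lexx 0)) expectation_start; last exact: continuous_measurable_fun.
have -> : \int[P]_w L g g1 g2 (0 + X c w) = \int[P]_w L g g1 g2 (X c w).
  by apply: eq_Rintegral => w _; rewrite add0r.
rewrite subr0 => mvt.
pose h y := L g g1 g2 y - L f f1 f2 0.
have mh : measurable_fun setT h.
  apply: measurable_funB; last exact: measurable_cst.
  exact: continuous_measurable_fun.
have h1 : `|\int[P]_w h (X c w)| <=
    (e + (K' * e' + e' * D)) + 3 * K * (C + 1) * fine (P (far delta c)).
  apply: expectation_le => //.
  - by rewrite !addr_ge0 ?mulr_ge0 ?(ltW e'0) ?(ltW K'0).
  - move=> y yd; rewrite /h -(subrK (L f f1 f2 y) (L g g1 g2 y)) -addrA.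
    by apply: le_trans (ler_normD _ _) _; have := Lgf y yd; have := He y yd; lra.
  - move=> y; rewrite /h; apply: le_trans (ler_normB _ _) _.
    have := HK _ _ _ _ y bG; have := HK _ _ _ _ 0 bf.
    have : K * C <= K * (C + 1) by rewrite ler_wpM2l ?(ltW K0)// lerDl.
    lra.
have hE : \int[P]_w h (X c w) = \int[P]_w L g g1 g2 (X c w) - L f f1 f2 0.
  have [_ ig] := integrable_smooth 0 c sg.
  have ig' : P.-integrable setT (EFin \o (fun w => L g g1 g2 (X c w))).
    by apply: eq_integrable ig => // w _ /=; rewrite add0r.
  rewrite RintegralB//; last exact: finite_measure_integrable_cst.
  by rewrite Rintegral_cst_prob.
have h2 : `|\int[P]_w (g (X t w) - f (X t w))| <= e' + D * fine (P (far M t)).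
  apply: (@expectation_le (fun y => g y - f y)).
  - by apply: measurable_funB; exact: continuous_measurable_fun.
  - exact: ltW.
  - by move=> y /ag[].
  - by move=> y; have [_ _ /(_ y)[+ _ _]] := bd; rewrite mulN1r.
have ifX : P.-integrable setT (EFin \o (fun w => f (X t w))).
  have [i _] := integrable_smooth 0 t sf.
  by apply: eq_integrable i => // w _ /=; rewrite add0r.
have igX : P.-integrable setT (EFin \o (fun w => g (X t w))).
  have [i _] := integrable_smooth 0 t sg.
  by apply: eq_integrable i => // w _ /=; rewrite add0r.
rewrite RintegralB// in h2.
have [h3 _ _] := ag 0 ltac:(by rewrite normr0 ltW).
rewrite hE in h1.
have pM : D * fine (P (far M t)) <= D * e'.
  rewrite ler_wpM2l// HM1// /M; lra.
have pc : 3 * K * (C + 1) * fine (P (far delta c)) <= 3 * K * (C + 1) * p.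
  rewrite ler_wpM2l// ?Hp// !mulr_ge0 ?(ltW K0)//; lra.
set a := \int[P]_w f (X t w) in h2 *.
set b := \int[P]_w g (X t w) in h2 mvt *.
set m := \int[P]_w L g g1 g2 (X c w) in h1 mvt.
have -> : a - f 0 - t * L f f1 f2 0 =
    - (b - a) + (g 0 - f 0) + t * (m - L f f1 f2 0).
  have Em : t * m = b - g 0 by rewrite mulrC mvt.
  by rewrite mulrBr Em; ring.
apply: le_trans (ler_normD3 _ _ _) _; rewrite normrN normrM (gtr0_norm t0).
have h1' : t * `|m - L f f1 f2 0| <=
    t * (e + (K' * e' + e' * D) + 3 * K * (C + 1) * p).
  by rewrite ler_wpM2l ?(ltW t0)//; lra.
apply: (@le_trans _ _ (t * (e + 3 * K * (C + 1) * p) + e' * Z)); last by lra.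
rewrite /Z; lra.
Qed.

(** The estimate at the origin applies to every translate of [f] with the same
constants, because the image of [f] is uniformly continuous. *)
Lemma uniform_increment_estimate f f1 f2 C (e : R) : C2_bounded f f1 f2 C ->
  unif_cts f2 -> 0 < e -> exists2 t0 : R, 0 < t0 & forall t x : R, 0 < t -> t < t0 ->
  `|\int[P]_w f (x + X t w) - f x - t * L f f1 f2 x| <= t * e.
Proof.
move=> bf uc e0.
have C0 : 0 <= C by have [_ _ /(_ 0)[+ _ _]] := bf; apply: le_trans.
have [K K0 HK] := increment_estimate.
have [|delta delta0 Hd] := levy_op_unif_cts A gamma lnu bf uc (e := e / 2).
  by rewrite divr_gt0.
have KC : 0 < K * (C + 1) by rewrite mulr_gt0// ltr_wpDl.
have [||t0 t00 Ht] := @far_small_time delta (e / 2 / (K * (C + 1))) => //.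
  by rewrite !divr_gt0.
exists t0 => // t x tgt0 tt0.
have bx := C2_bounded_shift x bf.
have ucx : unif_cts (fun y => f2 (y + x)).
  move=> e1 /uc[d1 d10 H1]; exists d1 => // y z yz; apply: H1.
  by rewrite (_ : y + x - (z + x) = y - z)//; ring.
have := HK _ _ _ _ delta (e / 2) (e / 2 / (K * (C + 1))) t bx ucx delta0.
rewrite levy_op_shift !add0r.
have -> : \int[P]_w f (X t w + x) = \int[P]_w f (x + X t w).
  by apply: eq_Rintegral => w _; rewrite addrC.
have -> : K * (C + 1) * (e / 2 / (K * (C + 1))) = e / 2.
  by rewrite mulrC divfK// gt_eqF.
rewrite -splitr; apply => //; first by rewrite divr_ge0 ?ltW.
- move=> y yd; rewrite levy_op_shift; apply: Hd.
  by rewrite (_ : y + x - x = y)//; ring.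
- by move=> s s0 st; apply: Ht => //; exact: lt_trans tt0.
Qed.

Lemma generator_graph_levy_op f f1 f2 C : C2_bounded f f1 f2 C ->
  C0 f -> C0 f1 -> C0 f2 -> generator_graph X f (L f f1 f2).
Proof.
move=> bf Cf Cf1 Cf2; have uc := C0_unif_cts Cf2.
split => //; first exact: levy_op_C0 bf uc Cf Cf1 Cf2.
move=> S /uniform_nbhs[E [entE ES]].
have [e /= e0 Ee] := entE.
have [|t0 t00 Ht] := uniform_increment_estimate bf uc (e := e / 2).
  by rewrite divr_gt0.
exists t0 => //= t; rewrite /ball_/= sub0r normrN => tt0 tgt0.
apply: ES => x _; apply: Ee => /=.
have := Ht t x tgt0; rewrite (gtr0_norm tgt0) in tt0 => /(_ tt0).
rewrite -/(transition_semigroup X t f x) => H.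
have -> : L f f1 f2 x - (transition_semigroup X t f x - f x) / t =
  - (transition_semigroup X t f x - f x - t * L f f1 f2 x) / t.
  by field; rewrite gt_eqF.
rewrite normrM normrN normfV (gtr0_norm tgt0) ltr_pdivrMr//.
apply: le_lt_trans H _; rewrite mulrC ltr_pM2r//.
by rewrite ltr_pdivrMr// ltr_pMr// ltr1n.
Qed.

Lemma generator_graph_unique f g h :
  generator_graph X f g -> generator_graph X f h -> g = h.
Proof.
move=> [_ _ ug] [_ _ uh]; apply/funext => x.
have H k : {uniform, (fun t => fun x => (transition_semigroup X t f x - f x) / t)
    @ 0^'+ --> k} ->
    (transition_semigroup X t f x - f x) / t @[t --> 0^'+] --> k x.
  move=> uk; apply/cvgrPdist_lt => e e0.
  have S : nbhs (k : {uniform R -> R}) [set g0 | forall y, `|k y - g0 y| < e].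
    apply/uniform_nbhs; exists [set xy | `|xy.1 - xy.2| < e]; split.
      by exists e.
    by move=> g0 /= Hg y; exact: Hg.
  have : \forall t \near 0^'+,
      forall y, `|k y - (transition_semigroup X t f y - f y) / t| < e := uk _ S.
  by apply: filterS => t; exact.
exact: (cvg_unique _ (H _ ug) (H _ uh)).
Qed.

Lemma generatorE f f1 f2 C : C2_bounded f f1 f2 C ->
  C0 f -> C0 f1 -> C0 f2 ->
  generator_domain X f /\ generator X f = L f f1 f2.
Proof.
move=> bf Cf Cf1 Cf2; have G := generator_graph_levy_op bf Cf Cf1 Cf2.
have D : generator_domain X f by exists (L f f1 f2).
split => //; apply: (@generator_graph_unique f) => //.
exact: (@xgetPex _ (fun=> 0) [set g | generator_graph X f g]).
Qed.

End process.

(** * The convolution kernel *)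

Section kernel.
Variable R : realType.
Notation leb := (@lebesgue_measure R).

Lemma lebesgue_measure_translation (x : R) (S : set R) : measurable S ->
  pushforward leb (fun u : measurableTypeR R => (x + u : measurableTypeR R)) S = leb S.
Proof.
move=> mS; apply/esym/lebesgue_measure_unique => //=.
  exact: measurable_funD.
move=> mx _ [[a b]] _ <-.
rewrite /pushforward /=.
have -> : (fun u : R => x + u) @^-1` `]a, b] = `](a - x), (b - x)]%classic.
  by apply/seteqP; split => u /=; rewrite !in_itv/= ltrBlDl lerBrDl.
rewrite !lebesgue_measure_itv/= !lte_fin ltrD2r.
by case: ifP => // _; rewrite -!EFinB; congr EFin; ring.
Qed.

Lemma integral_translation (x : R) (f : R -> \bar R) : measurable_fun setT f ->
  leb.-integrable setT (fun u => f (x + u)%R) ->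
  (\int[leb]_z f z = \int[leb]_u f (x + u)%R)%E.
Proof.
move=> mf intf.
have mx : measurable_fun setT (fun u : measurableTypeR R => (x + u : measurableTypeR R)).
  exact: measurable_funD.
have E := integral_pushforward mx mf.
apply: eq_trans (E leb setT intf measurableT).
by apply: eq_measure_integral => S mS _; exact/esym/lebesgue_measure_translation.
Qed.

(** [kernel_of_jump y] is the contribution to the kernel of a jump of size [y]:
its pairing with the second derivative of [f], translated by [x], is
[f (x + y) - f x - y f' x 1_{|y| < 1}].  It lives on the half-line on the side of
the jump, where it is linear up to [y] and constant beyond. *)
Definition kernel_of_jump (y u : R) : R :=
  (0 < u * y)%R%:R * (`|y| * (`|y| < 1)%R%:R - Num.min `|u| `|y|).

(** On the segment of half-length [a], the function [kernel_of_jump y] is bounded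
by [jump_reach a y] and vanishes at distance more than [jump_reach a y] from 0.
The square of this reach is dominated by [jump_weight], which is what makes the
kernel locally integrable. *)
Definition jump_reach (a y : R) : R := if `|y| < 1 then `|y| else a.

Lemma kernel_of_jump_le_time (y u a : R) : 0 <= a -> `|u| <= a ->
  `|kernel_of_jump y u| <= jump_reach a y *
    \1_(`[- jump_reach a y, jump_reach a y]%classic : set R) u.
Proof.
move=> a0 ua; set m := jump_reach a y.
have m0 : 0 <= m by rewrite /m /jump_reach; case: ifP.
rewrite indicE; have [_|um] := boolP (u \in _).
  rewrite mulr1 /kernel_of_jump; case: ltP => [uy|_]; last first.
    by rewrite mul0r normr0.
  rewrite /m /jump_reach.
  rewrite mul1r; have y0 := normr_ge0 y; have u0 := normr_ge0 u.
  have [y1|y1] := ltP `|y| 1.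
    rewrite mulr1 ger0_norm ?subr_ge0 ?ge_min ?lexx ?orbT//.
    by rewrite lerBlDr lerDl le_min u0.
  rewrite mulr0 sub0r normrN ger0_norm ?le_min ?u0//.
  by rewrite ge_min ua.
rewrite mulr0; move: um; rewrite notin_setE /= in_itv/= -ler_norml /m /jump_reach.
rewrite /kernel_of_jump; have [y1 /negP|y1 /(_ ua)//] := ltP `|y| 1.
by rewrite -ltNge => yu; rewrite mulr1 min_r ?(ltW yu)// subrr mulr0 normr0.
Qed.

(** Integrability in [y] for a fixed [u].  At [u = 0] the inverse is 0 by
convention and the left-hand side vanishes as well. *)
Lemma kernel_of_jump_le (y u : R) :
  `|kernel_of_jump y u| <= 2 * (`|u| + `|u|^-1) * jump_weight y.
Proof.
rewrite /kernel_of_jump; case: ltP => [uy|_]; last first.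
  rewrite mul0r normr0; apply: mulr_ge0; last exact: jump_weight_ge0.
  by apply: mulr_ge0 => //; rewrite addr_ge0// invr_ge0.
have u0 : 0 < `|u| by rewrite normr_gt0; apply: contraTneq uy => ->; rewrite mul0r ltxx.
have w0 := jump_weight_ge0 y.
have ui : 0 < `|u|^-1 by rewrite invr_gt0.
have y0 := normr_ge0 y.
rewrite mul1r; have [y1|y1] := ltP `|y| 1.
  have w1 := sqr_le_jump_weight (ltW y1).
  rewrite mulr1; have [uley|yltu] := leP `|u| `|y|.
    rewrite ger0_norm ?subr_ge0//.
    apply: (@le_trans _ _ (`|u|^-1 * y ^+ 2)).
      rewrite -ler_pdivrMl ?invr_gt0// invrK -(real_normK (num_real y)); nra.
    have : `|u|^-1 * y ^+ 2 <= `|u|^-1 * (2 * jump_weight y).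
      by rewrite ler_wpM2l// ltW.
    have := mulr_ge0 (ltW u0) w0; lra.
  rewrite subrr normr0.
  have := mulr_ge0 (ltW u0) w0; have := mulr_ge0 (ltW ui) w0; lra.
have w1 := one_le_jump_weight y1.
rewrite mulr0 sub0r normrN ger0_norm ?le_min ?normr_ge0//.
apply: (@le_trans _ _ `|u|); first by rewrite ge_min lexx.
have : `|u| * 1 <= `|u| * (2 * jump_weight y) by rewrite ler_wpM2l.
have := mulr_ge0 (ltW ui) w0; lra.
Qed.

Lemma measurable_kernel_of_jump :
  measurable_fun setT (fun z : R * R => kernel_of_jump z.2 z.1).
Proof.
have mb : measurable_fun setT (fun b : bool => b%:R : R) by [].
have m1 : measurable_fun setT (fun z : R * R => z.1) by exact: measurable_fst.
have m2 : measurable_fun setT (fun z : R * R => z.2) by exact: measurable_snd.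
have n1 : measurable_fun setT (fun z : R * R => `|z.1|) by exact: measurableT_comp.
have n2 : measurable_fun setT (fun z : R * R => `|z.2|) by exact: measurableT_comp.
apply: measurable_funM.
  apply: (measurableT_comp mb); apply: measurable_fun_ltr => //.
  exact: measurable_funM.
apply: measurable_funB; last exact: measurable_minr.
apply: measurable_funM => //; apply: (measurableT_comp mb).
exact: measurable_fun_ltr.
Qed.

(** The sets where [jump_weight] is at least [1 / n] have finite measure, and they
exhaust the complement of the null set [{0}]. *)
Lemma sigma_finite_levy_measure
  (nu : {measure set (measurableTypeR R) -> \bar R}) :
  levy_measure nu -> sigma_finite setT nu.
Proof.
move=> lnu.
pose S n := [set y : R | 1 <= n%:R * jump_weight y].
have mS n : measurable (S n).
  rewrite (_ : S n = (fun y => n%:R * jump_weight y) @^-1` `[1, +oo[); last first.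
    by apply/seteqP; split => y; rewrite /S /= in_itv/= andbT.
  rewrite -[X in measurable X]setTI.
  have mf : measurable_fun setT (fun y : R => n%:R * jump_weight y).
    by apply: measurable_funM => //; exact: measurable_jump_weight.
  by apply: mf.
exists (fun n => S n `|` [set 0]).
  apply/esym/seteqP; split => // y _.
  have [->|y0] := eqVneq y 0; first by exists 0%N => //; right.
  have w0 : 0 < jump_weight y.
    by rewrite /jump_weight divr_gt0 ?exprn_even_gt0// ltr_pwDl// sqr_ge0.
  exists (Num.truncn (jump_weight y)^-1).+1 => //; left.
  rewrite /S /= -ler_pdivrMr// mul1r.
  exact/ltW/truncnS_gt.
move=> n; split; first exact: measurableU (mS n) (measurable_set1 0).
have [nu0 _] := lnu.
have H : (nu (S n `|` [set 0%R]) <= nu (S n) + nu [set 0%R])%E.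
  by apply: measureU2; [exact: mS|exact: measurable_set1].
apply: le_lt_trans H _; rewrite nu0 adde0.
rewrite -[X in nu X]setIT -integral_indic; [|by []|exact: mS].
have iw := integrable_Rscale n%:R (integrable_jump_weight lnu).
move/integrableP : iw => [miw]; apply: le_lt_trans.
have mi : measurable_fun setT (EFin \o (\1_(S n) : R -> R)).
  by apply/measurable_EFinP; apply: measurable_indic; exact: mS.
apply: ge0_le_integral => //.
- exact: measurableT_comp.
- move=> y _ /=; rewrite lee_fin indicE.
  have [|_] := boolP (y \in S n); last by rewrite normr_ge0.
  by rewrite inE /S /= => H; apply: le_trans (ler_norm _).
Qed.

Lemma measurable_kernel_of_jump_pairing (h : R -> R) : measurable_fun setT h ->
  measurable_fun setT (fun z : R * R => (kernel_of_jump z.2 z.1 * h z.1)%:E).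
Proof.
move=> mh; apply/measurable_EFinP; apply: measurable_funM.
  exact: measurable_kernel_of_jump.
by apply: measurableT_comp => //; exact: measurable_fst.
Qed.

Lemma jump_reach_ge0 (a y : R) : 0 <= a -> 0 <= jump_reach a y.
Proof. by rewrite /jump_reach; case: ifP. Qed.

Lemma jump_reach_sqr_le (a y : R) :
  jump_reach a y ^+ 2 <= 2 * (1 + a ^+ 2) * jump_weight y.
Proof.
have w0 := jump_weight_ge0 y; have a2 := sqr_ge0 a.
rewrite /jump_reach; have [y1|y1] := ltP `|y| 1.
  rewrite real_normK ?num_real//; have := sqr_le_jump_weight (ltW y1).
  have := mulr_ge0 a2 w0; lra.
have : a ^+ 2 * 1 <= a ^+ 2 * (2 * jump_weight y).
  by rewrite ler_wpM2l// one_le_jump_weight.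
lra.
Qed.

Lemma integrable_kernel_of_jump (nu : {measure set (measurableTypeR R) -> \bar R}) u :
  levy_measure nu -> nu.-integrable setT (EFin \o kernel_of_jump^~ u).
Proof.
move=> lnu; apply: (integrable_of_jump_weight lnu (C := 2 * (`|u| + `|u|^-1))).
  exact: (measurableT_comp measurable_kernel_of_jump (pair1_measurable u)).
by move=> y; exact: kernel_of_jump_le.
Qed.

Section pairing.
Variables (h : R -> R) (a B : R).
Hypotheses (a0 : 0 <= a) (mh : measurable_fun setT h).
Hypotheses (hB : forall u, `|h u| <= B) (h0 : forall u, a < `|u| -> h u = 0).

Let B0 : 0 <= B. Proof. by apply: le_trans (hB 0). Qed.

Lemma kernel_of_jump_pairing_le (y u : R) :
  `|kernel_of_jump y u * h u| <= B * jump_reach a y *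
    \1_(`[- jump_reach a y, jump_reach a y]%classic : set R) u.
Proof.
have r0 := jump_reach_ge0 y a0.
have [ua|au] := leP `|u| a; last first.
  rewrite h0// mulr0 normr0 mulr_ge0//; first exact: mulr_ge0.
rewrite normrM mulrC -mulrA ler_pM//; exact: kernel_of_jump_le_time.
Qed.

Lemma integral_pairing_bound (y : R) :
  (\int[leb]_u (B * jump_reach a y *
    \1_(`[- jump_reach a y, jump_reach a y]%classic : set R) u)%:E =
  (2 * B * jump_reach a y ^+ 2)%:E)%E.
Proof.
have r0 := jump_reach_ge0 y a0.
under eq_integral do rewrite EFinM.
rewrite integralZl//; last first.
  by apply: integrable_indic_itv.
have -> : (\int[leb]_u (\1_(`[- jump_reach a y, jump_reach a y]%classic : set R) u)%:E =
    leb `[(- jump_reach a y)%R, jump_reach a y]%classic)%E.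
  by rewrite integral_indic// setIT.
rewrite lebesgue_measure_itv/= lte_fin.
case: ifPn => [_|]; first by rewrite -EFinB -EFinM; congr EFin; ring.
rewrite -leNgt => r1; rewrite mule0; congr EFin.
have -> : jump_reach a y = 0 by lra.
by rewrite expr0n mulr0.
Qed.

Lemma integrable_pairing_time (y : R) :
  leb.-integrable setT (EFin \o (fun u => kernel_of_jump y u * h u)).
Proof.
have ig : leb.-integrable setT (EFin \o (fun u : R => B * jump_reach a y *
    \1_(`[- jump_reach a y, jump_reach a y]%classic : set R) u)).
  by apply: integrable_Rscale; exact: integrable_indic_itv.
apply: le_integrable ig => //.
  exact: (measurableT_comp (measurable_kernel_of_jump_pairing mh) (pair2_measurable y)).
move=> u _ /=; rewrite lee_fin; apply: le_trans (kernel_of_jump_pairing_le y u) _.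
exact: ler_norm.
Qed.

(** For each [y] the integral of [|kernel_of_jump y u * h u|] in [u] is at most
[2 B (jump_reach a y)^2], which is integrable in [y]. *)
Lemma kernel_Fubini (nu : {sigma_finite_measure set (measurableTypeR R) -> \bar R}) :
  levy_measure nu ->
  leb.-integrable setT
    (EFin \o (fun u => (\int[nu]_y kernel_of_jump y u) * h u)) /\
  \int[leb]_u ((\int[nu]_y kernel_of_jump y u) * h u) =
  \int[nu]_y (\int[leb]_u (kernel_of_jump y u * h u)).
Proof.
move=> lnu.
pose F (z : R * R) := (kernel_of_jump z.2 z.1 * h z.1)%:E.
have mF : measurable_fun setT F by exact: measurable_kernel_of_jump_pairing.
have iF : (leb \x nu)%E.-integrable setT F.
  apply/(integrable21ltyP leb nu mF).
  have mG : measurable_fun setT (fun y => \int[leb]_u `|F (u, y)|)%E.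
    apply: (measurable_fun_fubini_tonelli_G (m1 := leb) (abse \o F)) => //.
      exact: measurableT_comp.
    by move=> z; exact: abse_ge0.
  have mw : measurable_fun setT
      (fun y => (2 * B * (2 * (1 + a ^+ 2)) * jump_weight y)%:E).
    apply/measurable_EFinP; apply: measurable_funM => //.
    exact: measurable_jump_weight.
  apply: (@le_lt_trans _ _
      (\int[nu]_y (2 * B * (2 * (1 + a ^+ 2)) * jump_weight y)%:E)%E).
    apply: ge0_le_integral => //.
    - by move=> y _; exact: integral_ge0.
    - move=> y _.
      apply: (@le_trans _ _ (2 * B * jump_reach a y ^+ 2)%:E); last first.
        have B2 : 0 <= 2 * B by rewrite mulr_ge0.
        by rewrite lee_fin; have := ler_wpM2l B2 (jump_reach_sqr_le a y); lra.
      rewrite -integral_pairing_bound.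
      have /integrableP[mk _] := integrable_pairing_time y.
      have mk' := measurableT_comp (@abse_measurable R setT) mk.
      have mi : measurable_fun setT (fun u : R => (B * jump_reach a y *
          \1_(`[- jump_reach a y, jump_reach a y]%classic : set R) u)%:E).
        by apply/measurable_EFinP; exact: measurable_funM.
      apply: ge0_le_integral => //.
      by move=> u _; rewrite lee_fin kernel_of_jump_pairing_le.
  have := integrable_Rscale (2 * B * (2 * (1 + a ^+ 2))) (integrable_jump_weight lnu).
  by move=> /integrable_lty; exact.
have Fu u : (\int[nu]_y F (u, y) = ((\int[nu]_y kernel_of_jump y u) * h u)%:E)%E.
  have ik := integrable_kernel_of_jump u lnu.
  rewrite EFinM /Rintegral fineK; last exact: integrable_fin_num.
  rewrite -integralZr//.
have Fy y : (\int[leb]_u F (u, y) = (\int[leb]_u (kernel_of_jump y u * h u))%:E)%E.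
  by rewrite /Rintegral fineK//; apply: integrable_fin_num => //; exact: integrable_pairing_time.
split.
  by apply: eq_integrable (integrable_fubini_F iF) => // u _; rewrite /fubini_F Fu.
rewrite /Rintegral; congr fine.
transitivity (\int[leb]_u \int[nu]_y F (u, y))%E.
  by apply: eq_integral => u _; rewrite Fu.
rewrite (Fubini iF).
by apply: eq_integral => y _; rewrite Fy.
Qed.

End pairing.

Lemma patch_oc (g : R -> R) (a b u : R) :
  (g \_ `]a, b]) u = if (a < u) && (u <= b) then g u else 0.
Proof. by rewrite patchE mem_setE in_itv. Qed.

Lemma patch_co (g : R -> R) (a b u : R) :
  (g \_ `[a, b[) u = if (a <= u) && (u < b) then g u else 0.
Proof. by rewrite patchE mem_setE in_itv. Qed.

Section fundamental_theorem.
Variables (F phi : R -> R).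
Hypotheses (dF : forall y : R, is_derive y 1 F (phi y)) (cphi : continuous phi).

Let cF : continuous F. Proof. exact: is_derive_cts dF. Qed.

Lemma integrable_continuous_itv (a b : R) :
  leb.-integrable `[a, b] (EFin \o phi).
Proof.
apply: continuous_compact_integrable; first exact: segment_compact.
exact: continuous_subspaceT.
Qed.

Lemma Rintegral_derivative (a b : R) : a <= b ->
  \int[leb]_(u in `[a, b]) phi u = F b - F a.
Proof.
rewrite le_eqVlt => /predU1P[->|ab].
  by rewrite set_itv1 Rintegral_set1 subrr.
rewrite /Rintegral (continuous_FTC2 (F := F) ab).
- by rewrite -EFinB.
- exact: continuous_subspaceT.
- split; first by move=> x _; have [] := dF x.
    by apply: cvg_at_right_filter; exact: cF.
  by apply: cvg_at_left_filter; exact: cF.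
- by move=> x _; rewrite derive1E; have [_ ->] := dF x.
Qed.

Lemma integral_piece_co (a b : R) : a <= b ->
  leb.-integrable setT (EFin \o (phi \_ `[a, b[)) /\
  \int[leb]_u (phi \_ `[a, b[) u = F b - F a.
Proof.
move=> ab.
have i1 : leb.-integrable `[a, b[ (EFin \o phi).
  by apply: integrableS (integrable_continuous_itv a b) => //; exact: subset_itv_co_cc.
split.
  by rewrite -restrict_EFin; apply/integrable_restrict => //=; rewrite setTI.
by rewrite -Rintegral_mkcond Rintegral_itv_bndo_bndc// Rintegral_derivative.
Qed.

Lemma integral_piece_oc (a b : R) : a <= b ->
  leb.-integrable setT (EFin \o (phi \_ `]a, b])) /\
  \int[leb]_u (phi \_ `]a, b]) u = F b - F a.
Proof.
move=> ab.
have i1 : leb.-integrable `]a, b] (EFin \o phi).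
  by apply: integrableS (integrable_continuous_itv a b) => //; exact: subset_itv_oc_cc.
split.
  by rewrite -restrict_EFin; apply/integrable_restrict => //=; rewrite setTI.
by rewrite -Rintegral_mkcond Rintegral_itv_obnd_cbnd// Rintegral_derivative.
Qed.

End fundamental_theorem.

Lemma is_derive_translate (f f1 : R -> R) (x u : R) :
  (forall y : R, is_derive y 1 f (f1 y)) ->
  is_derive u 1 (fun u => f (x + u)) (f1 (x + u)).
Proof.
move=> df.
have dx : is_derive u 1 (fun u : R => x + u) 1.
  have -> : (fun u : R => x + u) = (fun u : R => u + x).
    by apply/funext => v; rewrite addrC.
  by apply: trigger_derive; rewrite addr0.
rewrite -[X in is_derive _ _ _ X]mulr1.
exact: (@is_derive1_comp R f (fun u : R => x + u) u _ _ (df _) dx).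
Qed.

Lemma continuous_translate (f : R -> R) x : continuous f ->
  continuous (fun u => f (x + u)).
Proof.
move=> cf u; apply: (@continuous_comp _ _ _ (fun u : R => x + u) f); last exact: cf.
by apply: cvgD; [exact: cvg_cst|exact: cvg_id].
Qed.

(** A product with the measure [nu] requires its structure of sigma-finite measure,
which comes from integrability of [jump_weight]. *)
Lemma kernel_Fubini_levy (nu : {measure set (measurableTypeR R) -> \bar R})
    (h : R -> R) (a B : R) : 0 <= a ->
  measurable_fun setT h -> (forall u, `|h u| <= B) ->
  (forall u, a < `|u| -> h u = 0) -> levy_measure nu ->
  leb.-integrable setT
    (EFin \o (fun u => (\int[nu]_y kernel_of_jump y u) * h u)) /\
  \int[leb]_u ((\int[nu]_y kernel_of_jump y u) * h u) =
  \int[nu]_y (\int[leb]_u (kernel_of_jump y u * h u)).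
Proof.
move=> a0 mh hB h0 lnu; have sf := sigma_finite_levy_measure lnu.
pose nus : {sigma_finite_measure set (measurableTypeR R) -> \bar R} :=
  HB.pack_for (SigmaFiniteMeasure.type (measurableTypeR R) R) (Measure.sort nu)
    (isSFinite.Build _ _ _ _ (sfinite_measure_sigma_finite sf))
    (isSigmaFinite.Build _ _ _ _ sf).
exact: (@kernel_Fubini h a B a0 mh hB h0 nus lnu).
Qed.

Section triplet.
Variables (gamma : R) (nu : {measure set (measurableTypeR R) -> \bar R}).
Hypothesis lnu : levy_measure nu.

(** The step [- gamma 1_{u > 0}] is the kernel of the drift: its pairing with the
second derivative of [f], translated by [x], is [gamma f' x]. *)
Definition conv_kernel (u : R) : R :=
  - gamma * (0 < u)%R%:R + \int[nu]_y kernel_of_jump y u.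

Lemma conv_kernel_pairing (h : R -> R) (a B : R) : 0 <= a ->
  measurable_fun setT h -> (forall u, `|h u| <= B) ->
  (forall u, a < `|u| -> h u = 0) ->
  leb.-integrable setT (EFin \o (fun u => conv_kernel u * h u)) /\
  \int[leb]_u (conv_kernel u * h u) =
    - gamma * \int[leb]_u ((0 < u)%R%:R * h u) +
    \int[nu]_y (\int[leb]_u (kernel_of_jump y u * h u)).
Proof.
move=> a0 mh hB h0.
have [iK EK] := kernel_Fubini_levy a0 mh hB h0 lnu.
have B0 : 0 <= B by apply: le_trans (hB 0).
have ih : leb.-integrable setT (EFin \o (fun u : R => (0 < u)%R%:R * h u)).
  have ig : leb.-integrable setT (EFin \o (fun u : R =>
      B * \1_(`[- a, a]%classic : set R) u)).
    by apply: integrable_Rscale; exact: integrable_indic_itv.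
  apply: le_integrable ig => //.
    apply/measurable_EFinP; apply: measurable_funM => //.
    apply: (@measurableT_comp _ _ _ _ _ _ (fun b : bool => b%:R : R)) => //.
    exact: measurable_fun_ltr.
  move=> u _ /=; rewrite lee_fin indicE; have [ua|au] := leP `|u| a.
    rewrite mem_set/=; last by rewrite in_itv/= -ler_norml.
    rewrite mulr1 (ger0_norm B0) normrM; apply: le_trans (hB u).
    by rewrite ler_piMl// ger0_norm// lern1 leq_b1.
  by rewrite h0// mulr0 normr0.
have ig := integrable_Rscale (- gamma) ih.
have E u : conv_kernel u * h u =
    - gamma * ((0 < u)%R%:R * h u) + (\int[nu]_y kernel_of_jump y u) * h u.
  by rewrite /conv_kernel; ring.
split.
  by apply: eq_integrable (integrable_Radd ig iK) => // u _ /=; rewrite E.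
rewrite -EK -(RintegralZl _ measurableT ih) -(RintegralD measurableT ig iK).
by apply: eq_Rintegral => u _; rewrite E.
Qed.

Lemma conv_kernel_integrable_itv (a : R) : 0 <= a ->
  leb.-integrable setT
    (EFin \o (fun u => conv_kernel u * \1_(`[- a, a]%classic : set R) u)).
Proof.
move=> a0; have [||||+ _] := @conv_kernel_pairing (\1_(`[- a, a]%classic : set R)) a 1 => //.
- by move=> u; rewrite indicE ger0_norm// lern1 leq_b1.
- move=> u au; rewrite indicE memNset//= in_itv/= -ler_norml => ua.
  by move: au; rewrite ltNge ua.
Qed.

Lemma conv_kernel_locally_integrable : locally_integrable_off0 conv_kernel.
Proof.
move=> a a0.
have := conv_kernel_integrable_itv (ltW a0).
have mD : measurable (`[- a, a]%classic `\ 0 : set (measurableTypeR R)) by exact: measurableD.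
move=> /(integrableS measurableT mD (@subsetT _ _)).
apply: eq_integrable => //.
by move=> u; rewrite inE => -[ua _] /=; rewrite indicE mem_set// mulr1.
Qed.

(** * Pairing the kernel with a test function *)

Section test_function.
Variables (f f1 f2 : R -> R) (M : R).
Hypotheses (df : forall y : R, is_derive y 1 f (f1 y)).
Hypotheses (df1 : forall y : R, is_derive y 1 f1 (f2 y)) (cf2 : continuous f2).
Hypotheses (M0 : 0 < M) (f1M : forall z, M <= `|z| -> f1 z = 0)
  (f2M : forall z, M <= `|z| -> f2 z = 0).

Let reach (x u : R) : M + `|x| <= `|u| -> M <= `|x + u|.
Proof. by move=> H; have := ler_normB (x + u) x; rewrite addrAC subrr add0r; lra. Qed.

(** Integration by parts on both sides of the kink of the kernel at [y]. *)
Lemma kernel_of_jump_pairing (x y : R) :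
  \int[leb]_u (kernel_of_jump y u * f2 (x + u)) = jump f f1 x y.
Proof.
pose c : R := `|y| * (`|y| < 1)%R%:R.
pose B := M + `|x| + `|y|.
have x0 := normr_ge0 x; have y0 := normr_ge0 y.
have Mx : 0 <= M + `|x| by rewrite addr_ge0// ltW.
have B0 : 0 <= B by rewrite /B addr_ge0.
have cx2 := @continuous_translate f2 x cf2.
have d2 (u : R) := is_derive_translate x u df1.
have d1 (u : R) := is_derive_translate x u df.
have dscale k (u : R) : is_derive u 1 (fun u => k * f1 (x + u)) (k * f2 (x + u)).
  by have := d2 u => ?; apply: trigger_derive; rewrite /GRing.scale/=.
have cscale k : continuous (fun u => k * f2 (x + u)).
  by move=> u; apply: cvgM; [exact: cvg_cst|exact: cx2].
have [y_lt0|y_gt0|->] := ltgtP y 0; last first.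
- rewrite /jump !mul0r subr0 addr0 subrr.
  rewrite (_ : \int[leb]_u _ = \int[leb]_u (0 : R)); last first.
    by apply: eq_Rintegral => u _; rewrite /kernel_of_jump mulr0 ltxx !mul0r.
  by rewrite Rintegral_cst// mul0r.
- have yE : `|y| = y by rewrite gtr0_norm.
  have [||i1 e1] := @integral_piece_oc (fun u => (c - u) * f1 (x + u) + f (x + u))
    (fun u => (c - u) * f2 (x + u)) _ _ 0 y (ltW y_gt0).
  + move=> u; have := d2 u; have := d1 u => ? ?.
    by apply: trigger_derive; rewrite /GRing.scale/=; ring.
  + move=> u; apply: cvgM; last exact: cx2.
    by apply: cvgB; [exact: cvg_cst|exact: cvg_id].
  have yB : y <= B by rewrite /B yE lerDr.
  have [i2 e2] := integral_piece_oc (dscale (c - y)) (cscale (c - y)) yB.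
  rewrite (_ : \int[leb]_u _ = \int[leb]_u
     (((fun u => (c - u) * f2 (x + u)) \_ `]0, y]) u +
      ((fun u => (c - y) * f2 (x + u)) \_ `]y, B]) u)); last first.
    apply: eq_Rintegral => u _.
    rewrite !patch_oc /kernel_of_jump (pmulr_lgt0 _ y_gt0) -/c yE.
    case: (leP u 0) => u0 /=.
      by rewrite mul0r mul0r ltNge (le_trans u0 (ltW y_gt0)) /= addr0.
    rewrite mul1r (gtr0_norm u0); case: (leP u y) => uy /=; first by rewrite addr0.
    rewrite add0r; case: (leP u B) => // uB.
    by rewrite f2M ?mulr0//; apply: reach; rewrite (gtr0_norm u0); move: uB; rewrite /B; lra.
  rewrite RintegralD// e1 e2 (f1M (z := x + B)); last first.
    by apply: reach; rewrite (ger0_norm B0) /B lerDl.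
  by rewrite /jump /c yE !addr0; ring.
- have yE : `|y| = - y by rewrite ltr0_norm.
  have [||i1 e1] := @integral_piece_co (fun u => (c + u) * f1 (x + u) - f (x + u))
    (fun u => (c + u) * f2 (x + u)) _ _ y 0 (ltW y_lt0).
  + move=> u; have := d2 u; have := d1 u => ? ?.
    by apply: trigger_derive; rewrite /GRing.scale/=; ring.
  + move=> u; apply: cvgM; last exact: cx2.
    by apply: cvgD; [exact: cvg_cst|exact: cvg_id].
  have yB : - B <= y by rewrite /B yE opprB lerBlDr lerDl.
  have [i2 e2] := integral_piece_co (dscale (c + y)) (cscale (c + y)) yB.
  rewrite (_ : \int[leb]_u _ = \int[leb]_u
     (((fun u => (c + u) * f2 (x + u)) \_ `[y, 0[) u +
      ((fun u => (c + y) * f2 (x + u)) \_ `[(- B), y[) u)); last first.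
    apply: eq_Rintegral => u _.
    rewrite !patch_co /kernel_of_jump (nmulr_lgt0 _ y_lt0) -/c yE.
    case: (leP 0 u) => u0 /=.
      rewrite mul0r mul0r andbF add0r.
      by rewrite [u < y]ltNge (le_trans (ltW y_lt0) u0) andbF.
    rewrite mul1r andbT (ltr0_norm u0); case: (leP y u) => uy /=.
      by rewrite min_l ?lerN2// opprK andbF addr0.
    rewrite add0r andbT min_r ?lerN2 ?(ltW uy)// opprK.
    case: (leP (- B) u) => // uB.
    by rewrite f2M ?mulr0//; apply: reach; rewrite (ltr0_norm u0); move: uB; rewrite /B; lra.
  rewrite RintegralD// e1 e2 (f1M (z := x + - B)); last first.
    by apply: reach; rewrite normrN (ger0_norm B0) /B lerDl.
  by rewrite /jump /c yE !addr0; ring.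
Qed.

Hypothesis ucf2 : unif_cts f2.
Variable C : R.
Hypothesis bf : forall z, `|f1 z| <= C /\ `|f2 z| <= C.

(** Exchange the integrals in [u] and [y], then pair each jump separately. *)
Lemma conv_kernel_generator (x : R) :
  \int[leb]_u (conv_kernel u * f2 (x + u)) =
  gamma * f1 x + \int[nu]_y jump f f1 x y.
Proof.
have x0 := normr_ge0 x.
have B0 : 0 <= M + `|x| by rewrite addr_ge0// ltW.
have cx2 := @continuous_translate f2 x cf2.
have dx (u : R) := is_derive_translate x u df1.
have [||||_ ->] := @conv_kernel_pairing (fun u => f2 (x + u)) (M + `|x|) C => //.
- exact: continuous_measurable_fun.
- by move=> u; have [] := bf (x + u).
- by move=> u /ltW/reach/f2M.
congr (_ + _); last by apply: eq_Rintegral => y _; exact: kernel_of_jump_pairing.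
have [_ E] := integral_piece_oc dx cx2 B0.
rewrite (_ : \int[leb]_u _ = \int[leb]_u
    ((fun u => f2 (x + u)) \_ `]0, (M + `|x|)]) u); last first.
  apply: eq_Rintegral => u _; rewrite patch_oc.
  case: (leP u 0) => u0 /=; first by rewrite mul0r.
  rewrite mul1r; case: (leP u (M + `|x|)) => // uM.
  by apply: f2M; apply: reach; rewrite (gtr0_norm u0) ltW.
rewrite E (f1M (z := x + (M + `|x|))) ?addr0; first by ring.
by apply: reach; rewrite (ger0_norm B0).
Qed.

Definition convolution (x : R) : R :=
  \int[leb]_(z in [set~ x]) (conv_kernel (z - x) * f1 z).

Lemma integrable_conv_f1 (x : R) :
  leb.-integrable setT (EFin \o (fun u => conv_kernel u * f1 (x + u))).
Proof.
have B0 : 0 <= M + `|x| by rewrite addr_ge0// ltW.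
have [||||+ _] := @conv_kernel_pairing (fun u => f1 (x + u)) (M + `|x|) C => //.
- apply: continuous_measurable_fun; apply: continuous_translate.
  exact: is_derive_cts df1.
- by move=> u; have [] := bf (x + u).
- by move=> u /ltW/reach/f1M.
Qed.

Lemma integrable_conv_f2 (x : R) :
  leb.-integrable setT (EFin \o (fun u => conv_kernel u * f2 (x + u))).
Proof.
have B0 : 0 <= M + `|x| by rewrite addr_ge0// ltW.
have [||||+ _] := @conv_kernel_pairing (fun u => f2 (x + u)) (M + `|x|) C => //.
- by apply: continuous_measurable_fun; exact: continuous_translate.
- by move=> u; have [] := bf (x + u).
- by move=> u /ltW/reach/f2M.
Qed.

Lemma convolutionE (x : R) :
  convolution x = \int[leb]_u (conv_kernel u * f1 (x + u)).
Proof.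
have i1 := integrable_conv_f1 x.
have mg : measurable_fun setT (fun z : R => (conv_kernel (z - x) * f1 z)%:E).
  have /integrableP[m1 _] := i1.
  have ms : measurable_fun setT (fun z : R => z - x) by exact: measurable_funB.
  have := measurableT_comp m1 ms.
  by congr (measurable_fun _ _); apply/funext => z /=; rewrite (addrC x) subrK.
rewrite /convolution /Rintegral; congr fine.
have -> : [set~ x] = [set: R] `\ x by rewrite setTD.
rewrite integral_setD1//; last first.
- exact: measurable_funTS.
- exact: measurableD.
rewrite (integral_translation (x := x) mg).
  by apply: eq_integral => u _; rewrite addrAC subrr add0r.
by apply: eq_integrable i1 => // u _ /=; rewrite addrAC subrr add0r.
Qed.

(** The uniform continuity of [f2] makes the difference quotients of [f1] converge
uniformly, and they all vanish outside one segment, on which the kernel is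
integrable. *)
Lemma is_derive_convolution (x : R) :
  is_derive x 1 convolution (\int[leb]_u (conv_kernel u * f2 (x + u))).
Proof.
apply: is_derive_of_increment => e e0.
pose a := M + `|x| + 1.
have a0 : 0 <= a by rewrite !addr_ge0// ltW.
pose I := \int[leb]_u `|conv_kernel u * \1_(`[- a, a]%classic : set R) u|.
have I0 : 0 <= I by apply: Rintegral_ge0.
have ik := conv_kernel_integrable_itv a0.
have e1 : 0 < e / (I + 1) by rewrite divr_gt0// ltr_wpDl.
have [d d0 Hd] := ucf2 e1.
exists (Num.min d 1); first by rewrite lt_min d0 ltr01.
move=> h; rewrite le_min => /andP[hd h1].
pose r u := f1 (x + h + u) - f1 (x + u) - h * f2 (x + u).
have rle u : `|r u| <= e / (I + 1) * `|h|.
  have dv (s : R) : is_derive s 1 (fun s => f1 (x + u + s) - s * f2 (x + u))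
      (f2 (x + u + s) - f2 (x + u)).
    have := is_derive_translate (x + u) s df1 => ?.
    by apply: trigger_derive; rewrite /GRing.scale/=; ring.
  have := MVT_le 0 h (e / (I + 1)) dv.
  rewrite add0r !addr0 mul0r subr0 /r (addrAC x h u) => H.
  rewrite (_ : _ - _ - _ = f1 (x + u + h) - h * f2 (x + u) - f1 (x + u)); last by ring.
  apply: H => s; rewrite subr0 => sh; apply: Hd.
  by rewrite addrAC subrr add0r (le_trans sh).
have r0 u : a < `|u| -> r u = 0.
  move=> au.
  have xu : M <= `|x + u| by apply: reach; rewrite /a in au; lra.
  have xhu : M <= `|x + h + u|.
    apply: reach; have := ler_normD x h; rewrite /a in au; lra.
  by rewrite /r !f1M// f2M// mulr0 !subr0.
have i1 := integrable_conv_f1 (x + h); have i0 := integrable_conv_f1 x.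
have i2 := integrable_conv_f2 x.
have i2' := integrable_Rscale h i2.
have iB : leb.-integrable setT (EFin \o (fun u =>
    conv_kernel u * f1 (x + h + u) - conv_kernel u * f1 (x + u))).
  have := integrable_Radd i1 (integrable_Rscale (-1) i0).
  by apply: eq_integrable => // u _ /=; rewrite mulN1r.
have ir : leb.-integrable setT (EFin \o (fun u => conv_kernel u * r u)).
  have := integrable_Radd iB (integrable_Rscale (-1) i2').
  by apply: eq_integrable => // u _ /=; rewrite /r; congr EFin; ring.
rewrite !convolutionE -(RintegralZl _ measurableT i2) -(RintegralB measurableT i1 i0).
rewrite -(RintegralB measurableT iB i2').
rewrite (_ : \int[leb]_u _ = \int[leb]_u (conv_kernel u * r u)); last first.
  by apply: eq_Rintegral => u _; rewrite /r; ring.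
apply: le_trans (le_normr_Rintegral measurableT ir) _.
apply: (@le_trans _ _ (\int[leb]_u (e / (I + 1) * `|h| *
    `|conv_kernel u * \1_(`[- a, a]%classic : set R) u|))).
  apply: le_Rintegral => //.
  - exact: integrable_norm.
  - by apply: integrable_Rscale; exact: integrable_norm.
  move=> u _; rewrite !normrM.
  have [ua|au] := leP `|u| a; last first.
    rewrite r0// normr0 mulr0; apply: mulr_ge0; last exact: mulr_ge0.
    by apply: mulr_ge0; [exact: ltW|exact: normr_ge0].
  rewrite indicE mem_set/=; last by rewrite in_itv/= -ler_norml.
  by rewrite normr1 mulr1 mulrC ler_wpM2r.
rewrite RintegralZl//; last exact: integrable_norm.
rewrite -/I mulrAC ler_wpM2r// -mulrA ger_pMr// mulrC ler_pdivrMr ?ltr_wpDl//.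
by rewrite mul1r lerDl.
Qed.

End test_function.
End triplet.
End kernel.

(** * The convolution form *)

Section convolution_form.
Variable R : realType.

Lemma derive1_eq0_outside (f : R -> R) (M : R) :
  (forall z, M < `|z| -> f z = 0) -> forall z, M < `|z| -> derive1 f z = 0.
Proof.
move=> fM z Mz; rewrite derive1E.
rewrite (near_eq_derive (g := cst 0)) ?derive_cst//.
exists (`|z| - M); first by rewrite /= subr_gt0.
move=> y /= zy; apply: fM.
by have := ler_normD (z - y) y; rewrite subrK; lra.
Qed.

Lemma compactly_supported_bound (f : R -> R) : compactly_supported f ->
  exists2 M : R, 0 < M & forall z, M < `|z| -> f z = 0.
Proof.
move=> /compact_bounded[M [_ HM]].
exists (`|M| + 1); first by rewrite ltr_wpDl.
move=> z Mz; apply/eqP; apply: contraTT Mz => fz.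
rewrite -leNgt; apply: HM; last by apply: subset_closure.
by apply: (le_lt_trans (ler_norm M)); rewrite ltrDl.
Qed.

Lemma is_derive_derive1 (f : R -> R) : (forall x, derivable f x 1) ->
  forall x : R, is_derive x 1 f (derive1 f x).
Proof. by move=> df x; apply: DeriveDef => //; rewrite derive1E. Qed.

End convolution_form.

Unset Implicit Arguments.
Set Strict Implicit.

Theorem theorem2p6 (R : realType) (d : measure_display) (T : measurableType d)
    (P : probability T R) (X : R -> {RV P >-> R}) (A gamma : R)
    (nu : {measure set (measurableTypeR R) -> \bar R}) :
  levy_process X -> levy_triplet X A gamma nu ->
  exists k : R -> R,
    locally_integrable_off0 k /\
    forall f : R -> R, C0_2 f -> compactly_supported f ->
      [/\ generator_domain X f,
          (forall x, derivable (conv_operator A k (derive1 f)) x 1) &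
          generator X f = derive1 (conv_operator A k (derive1 f))].
Proof.
move=> lX tX; have [_ lnu _] := tX.
exists (conv_kernel gamma nu); split; first exact: conv_kernel_locally_integrable.
move=> f [Cf [df Cf1] [df1 Cf2]] sf.
set f1 := derive1 f in df1 Cf1 Cf2 *; set f2 := derive1 f1 in Cf2.
have Df := is_derive_derive1 df; have Df1 := is_derive_derive1 df1.
rewrite -/f1 in Df; rewrite -/f2 in Df1.
have [c0 c00 b0] := C0_bounded Cf; have [c1 c10 b1] := C0_bounded Cf1.
have [c2 c20 b2] := C0_bounded Cf2.
have bf : C2_bounded f f1 f2 (c0 + c1 + c2).
  by split => // y; have := b0 y; have := b1 y; have := b2 y; split; lra.
have [dom gE] := generatorE lX tX bf Cf Cf1 Cf2.
have [M M0 fM] := compactly_supported_bound sf.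
have f1M := derive1_eq0_outside fM; have f2M := derive1_eq0_outside f1M.
have M1 : 0 < M + 1 by rewrite addr_gt0.
have MM (z : R) : M + 1 <= `|z| -> M < `|z|.
  by apply: lt_le_trans; rewrite ltrDl.
have ucf2 := C0_unif_cts Cf2.
have dG (x : R) : is_derive x 1 (conv_operator A (conv_kernel gamma nu) f1)
    (levy_op A gamma nu f f1 f2 x).
  have b12 (z : R) : `|f1 z| <= c1 + c2 /\ `|f2 z| <= c1 + c2.
    by have := b1 z; have := b2 z; split; lra.
  have cf2 := unif_cts_continuous ucf2.
  have f1M' z Mz := f1M z (MM z Mz); have f2M' z Mz := f2M z (MM z Mz).
  have := is_derive_convolution gamma lnu Df1 cf2 M1 f1M' f2M' ucf2 b12 x.
  rewrite (conv_kernel_generator gamma lnu Df Df1 cf2 M1 f1M' f2M' b12) => dC.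
  have dS : is_derive x 1 (fun x => A / 2 * f1 x + convolution gamma nu f1 x)
      (A / 2 * f2 x + (gamma * f1 x + \int[nu]_y jump f f1 x y)).
    by have := Df1 x => ?; apply: is_deriveD.
  by rewrite /levy_op -addrA; exact: dS.
split => [//|x|]; first by have [] := dG x.
by rewrite gE; apply/funext => x; rewrite derive1E; have [_ ->] := dG x.
Qed.
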